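(* Let $$U(z)=\frac{1}{2\pi i}\int_{|w|=1}w\exp\left\{\frac{z}{w}-\frac{1}{2w^2}-\frac{w^2}{2}\right\}dw,\qquad H(z)=\int_{A}w\exp\left\{\frac{z}{w}-\frac{1}{2w^2}-\frac{w^2}{2}\right\}dw .$$ Then the three functions $U(z)$, $H(z)$, $H(-z)$ are pairwise linearly independent solutions of the differential equation $$f^{(4)}-zf'''-f=0,$$ and they satisfy $$\rho(U(z))=\rho(H(z))=\rho(H(-z))=\frac23 .$$ Moreover, $$2\pi i\,U(z)\equiv H(z)+H(-z).$$
   Context: The circle $|w|=1$ is traversed once counterclockwise. The contour $A$ is $A=A_1+A_2+A_3$, where $A_1$: $w=r$, $r$ goes from $+\infty$ to $1$; $A_2$: $w=e^{i\theta}$, $\theta$ goes from $0$ to $\pi$; $A_3$: $w=-r$, $r$ goes from $1$ to $+\infty$. For an entire function $f$, $\rho(f)=\limsup_{r\to\infty}\frac{\log\log M(r,f)}{\log r}$ denotes its order, where $M(r,f)=\max_{|z|=r}|f(z)|$. Linear independence is over $\mathbb{C}$. *)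

(* Defs.v *)
From Stdlib Require Import Reals.
From Coquelicot Require Import Coquelicot.
Open Scope C_scope.

Definition Cexp (z : C) : C :=
  (exp (Re z) * cos (Im z), exp (Re z) * sin (Im z))%R.

Definition path_velocity (gamma : R -> C) (t : R) : C :=
  (Derive (fun s => Re (gamma s)) t, Derive (fun s => Im (gamma s)) t).

(* The path gamma is travelled from the end [Fa] of the parameter range to the
   end [Fb]; these are filters, so an end may be infinite and the parameter may
   decrease. *)
Definition contour_int (F : C -> C) (gamma : R -> C)
    (Fa Fb : (R -> Prop) -> Prop) : C :=
  RInt_gen (V := C_R_CompleteNormedModule)
    (fun t => F (gamma t) * path_velocity gamma t) Fa Fb.

Definition arc (theta : R) : C := Cexp (Ci * theta).

Definition unit_circle_int (F : C -> C) : C :=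
  contour_int F arc (at_point 0%R) (at_point (2 * PI)%R).

Definition contour_A_int (F : C -> C) : C :=
  contour_int F (fun r : R => RtoC r) (Rbar_locally p_infty) (at_point 1%R)
  + contour_int F arc (at_point 0%R) (at_point PI)
  + contour_int F (fun r : R => - RtoC r) (at_point 1%R) (Rbar_locally p_infty).

Definition kernel (z w : C) : C :=
  w * Cexp (z / w - 1 / (2 * w ^ 2) - w ^ 2 / 2).

Definition U (z : C) : C :=
  1 / (2 * PI * Ci) * unit_circle_int (kernel z).

Definition H (z : C) : C := contour_A_int (kernel z).

Definition is_C_derivative (f f' : C -> C) : Prop :=
  forall z : C, @is_derive C_AbsRing C_NormedModule f z (f' z).

(* f is an entire solution of f'''' - z f''' - f = 0. *)
Definition solves_ode (f : C -> C) : Prop :=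
  exists f1 f2 f3 f4 : C -> C,
    is_C_derivative f f1 /\ is_C_derivative f1 f2 /\
    is_C_derivative f2 f3 /\ is_C_derivative f3 f4 /\
    forall z : C, f4 z - z * f3 z - f z = 0.

Definition lin_indep (f g : C -> C) : Prop :=
  forall a b : C, (forall z : C, a * f z + b * g z = 0) -> a = 0 /\ b = 0.

Definition is_max_modulus (f : C -> C) (r m : R) : Prop :=
  (exists z : C, Cmod z = r /\ Cmod (f z) = m) /\
  (forall z : C, Cmod z = r -> (Cmod (f z) <= m)%R).

(* The analogue of [is_LimSup_seq] for a real variable tending to +oo. *)
Definition is_LimSup_p_infty (u : R -> R) (l : Rbar) : Prop :=
  match l with
  | Finite l =>
      forall eps : posreal,
        (forall N : R, exists r : R, (N <= r)%R /\ (l - eps < u r)%R) /\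
        (exists N : R, forall r : R, (N <= r)%R -> (u r < l + eps)%R)
  | p_infty => forall M N : R, exists r : R, (N <= r)%R /\ (M < u r)%R
  | m_infty => forall M : R, exists N : R, forall r : R, (N <= r)%R -> (u r < M)%R
  end.

(* [ln] vanishes on nonpositive arguments; for a nonconstant entire f one has
   M r > 1 for all large r, so this convention does not affect the limsup. *)
Definition is_order (f : C -> C) (rho : Rbar) : Prop :=
  exists M : R -> R,
    (forall r : R, (0 <= r)%R -> is_max_modulus f r (M r)) /\
    is_LimSup_p_infty (fun r => (ln (ln (M r)) / ln r)%R) rho.

(* Main.v *)
(** In the variable [u = 1/w], [U] and [H] are combinations of integrals
    [F n z = ∫ g(u) u^n e^(zu) du] with [n = 0] over paths in the closed unit
    disc, and [F n] is the [n]-th derivative.  Integrating [d(u^n e^phi)] for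
    [phi = zu - u^2/2 - 1/(2u^2)] gives
    [F (n+4) z - z F (n+3) z - n F (n+2) z - F n z = 0]; the case [n = 0] is the
    differential equation.  At [z = 0] it is a recurrence for the Taylor
    coefficients [a n = F n 0], which are bounded because [|u| <= 1]; solving it
    for [a (n+2)] forces [a n = O(1 / (n/2)!)], hence the bound
    [A exp (3 |z|^(2/3))], without any deformation of the contour.

    For the lower bound, [- U (ix)] is the mean over the circle of
    [w^2 exp (x/w + w^2/2 + w^(-2)/2)]; all Laurent coefficients are nonnegative,
    so a single term of the exponential series bounds it from below.  The
    identity [2 pi i U z = H z + H (-z)] transfers this to [H] and shows that [U]
    is even, so that independence reduces to [U <> 0] and [H' 0 <> 0]. *)

Require Import Defs.
From Stdlib Require Import Reals Factorial Lra Lia FunctionalExtensionality ZArith.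
From Coquelicot Require Import Coquelicot.
Open Scope C_scope.

(** * Calculus of functions from R to C *)

(** The estimates may be crude because the order ignores constants: [ln ln] turns a factor in front
    of the exponential, or the 3 in its exponent, into a vanishing error, and a limsup needs a lower
    bound only along one sequence of radii. The exponent 2/3 arises because [a n / n!] is bounded
    roughly by [(n!)^(-3/2)].

    Passing to u = 1/w also makes the integrals proper: each ray becomes a real segment ending at u
    = 0, where exp(-1/(2u^2)) is flat. One remainder estimate for e^(hu), uniform in |u| <= 1 and in
    the power of u, then gives complex differentiability, the Taylor expansion and the boundedness
    of the coefficients together.

    A ray or the half circle alone does not satisfy the recurrence: it leaves boundary terms at u =
    1 or u = -1. These cancel once the pieces form A, and by periodicity on the full circle.

    The imaginary axis is chosen for the lower bound because w = iv makes both quadratic terms of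
    the exponent positive, while z/w becomes x/v. *)

Lemma C_eq (x y : C) : Re x = Re y -> Im x = Im y -> x = y.
Proof. destruct x, y; simpl; congruence. Qed.

Lemma Cexp_plus (x y : C) : Cexp (x + y) = Cexp x * Cexp y.
Proof.
  destruct x as [a b], y as [c d]; apply C_eq; simpl; rewrite exp_plus.
  - rewrite cos_plus; ring.
  - rewrite sin_plus; ring.
Qed.

Lemma Cexp_RtoC (x : R) : Cexp (RtoC x) = RtoC (exp x).
Proof.
  apply C_eq; simpl; [rewrite cos_0 | rewrite sin_0]; ring.
Qed.

Lemma Cexp_0 : Cexp 0 = 1.
Proof. rewrite Cexp_RtoC, exp_0; reflexivity. Qed.

Lemma Cmod_Cexp (z : C) : Cmod (Cexp z) = exp (Re z).
Proof.
  unfold Cmod, Cexp; simpl.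
  replace (_ + _)%R with ((exp (Re z)) * (exp (Re z)) * ((sin (Im z))² + (cos (Im z))²))%R
    by (unfold Rsqr; ring).
  rewrite sin2_cos2, Rmult_1_r.
  apply sqrt_square, Rlt_le, exp_pos.
Qed.

Lemma exp_le (x y : R) : (x <= y)%R -> (exp x <= exp y)%R.
Proof. intros [h | ->]; [left; now apply exp_increasing | right; reflexivity]. Qed.

Lemma Cmod_Cexp_le (z : C) : (Cmod (Cexp z) <= exp (Cmod z))%R.
Proof.
  rewrite Cmod_Cexp; apply exp_le.
  eapply Rle_trans; [apply Rle_abs | apply re_le_Cmod].
Qed.

(** Continuity is required on the whole line, which spares domain conditions; integrands are
    therefore extended continuously beyond their natural range. *)
Definition ccont (f : R -> C) : Prop :=
  forall t, continuous (fun s => Re (f s)) t /\ continuous (fun s => Im (f s)) t.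

Lemma ccont_ext (f g : R -> C) : (forall t, f t = g t) -> ccont f -> ccont g.
Proof.
  intros e hf t; destruct (hf t) as [h1 h2]; split;
    [apply (continuous_ext (fun s => Re (f s))) | apply (continuous_ext (fun s => Im (f s)))];
    auto; intros; now rewrite e.
Qed.

Lemma ccont_const (c : C) : ccont (fun _ => c).
Proof. intro t; split; apply continuous_const. Qed.

Lemma ccont_RtoC (f : R -> R) :
  (forall t, continuous f t) -> ccont (fun t => RtoC (f t)).
Proof. intros hf t; split; [apply hf | apply continuous_const]. Qed.

Lemma ccont_pair (f g : R -> R) :
  (forall t, continuous f t) -> (forall t, continuous g t) -> ccont (fun t => (f t, g t)).
Proof. intros hf hg t; split; [apply hf | apply hg]. Qed.

Lemma ccont_plus (f g : R -> C) : ccont f -> ccont g -> ccont (fun t => f t + g t).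
Proof.
  intros hf hg t; destruct (hf t), (hg t); split; simpl;
    apply (continuous_plus (V := R_NormedModule)); assumption.
Qed.

Lemma ccont_mult (f g : R -> C) : ccont f -> ccont g -> ccont (fun t => f t * g t).
Proof.
  intros hf hg t; destruct (hf t), (hg t); split; simpl.
  - apply (continuous_minus (V := R_NormedModule));
      apply (continuous_mult (K := R_AbsRing)); assumption.
  - apply (continuous_plus (V := R_NormedModule));
      apply (continuous_mult (K := R_AbsRing)); assumption.
Qed.

Lemma ccont_opp (f : R -> C) : ccont f -> ccont (fun t => - f t).
Proof.
  intros hf; apply (ccont_ext (fun t => RtoC (-1) * f t)).
  - intro t; apply C_eq; simpl; ring.
  - apply ccont_mult; [apply ccont_const | exact hf].
Qed.

Lemma ccont_pow (f : R -> C) (n : nat) : ccont f -> ccont (fun t => f t ^ n).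
Proof.
  intros hf; induction n as [|n IH]; simpl; [apply ccont_const | now apply ccont_mult].
Qed.

Lemma ccont_Cexp (f : R -> C) : ccont f -> ccont (fun t => Cexp (f t)).
Proof.
  intros hf t; destruct (hf t) as [h1 h2]; split; simpl;
  apply (continuous_mult (K := R_AbsRing)).
  - apply (continuous_comp _ exp); [exact h1 | apply continuous_exp].
  - apply (continuous_comp _ cos); [exact h2 | apply continuous_cos].
  - apply (continuous_comp _ exp); [exact h1 | apply continuous_exp].
  - apply (continuous_comp _ sin); [exact h2 | apply continuous_sin].
Qed.

(** * Derivatives of complex functions of a real variable *)

Definition cderiv (f : R -> C) (t : R) (l : C) : Prop :=
  is_derive (fun s => Re (f s)) t (Re l) /\ is_derive (fun s => Im (f s)) t (Im l).

Lemma cderiv_eq (f : R -> C) (t : R) (l l' : C) : l = l' -> cderiv f t l -> cderiv f t l'.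
Proof. now intros ->. Qed.

Lemma cderiv_ext (f g : R -> C) (t : R) (l : C) :
  (forall s, f s = g s) -> cderiv f t l -> cderiv g t l.
Proof.
  intros e [h1 h2]; split;
    [apply (is_derive_ext (fun s => Re (f s))) | apply (is_derive_ext (fun s => Im (f s)))];
    auto; intros; now rewrite e.
Qed.

Lemma cderiv_const (c : C) (t : R) : cderiv (fun _ => c) t 0.
Proof. split; apply (is_derive_const (V := R_NormedModule)). Qed.

Lemma cderiv_RtoC (f : R -> R) (t l : R) : is_derive f t l -> cderiv (fun s => RtoC (f s)) t (RtoC l).
Proof. intros h; split; [exact h | exact (is_derive_const (V := R_NormedModule) 0%R t)]. Qed.

Lemma cderiv_id (t : R) : cderiv (fun s => RtoC s) t 1.
Proof. apply cderiv_RtoC, (is_derive_id (K := R_AbsRing)). Qed.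

Lemma cderiv_plus (f g : R -> C) (t : R) (l m : C) :
  cderiv f t l -> cderiv g t m -> cderiv (fun s => f s + g s) t (l + m).
Proof. intros [? ?] [? ?]; split; apply (is_derive_plus (V := R_NormedModule)); assumption. Qed.

Lemma cderiv_mult (f g : R -> C) (t : R) (l m : C) :
  cderiv f t l -> cderiv g t m -> cderiv (fun s => f s * g s) t (l * g t + f t * m).
Proof.
  intros [h1 h2] [h3 h4]; split; simpl.
  - replace (_ + _)%R with
      ((Re l * Re (g t) + Re (f t) * Re m) - (Im l * Im (g t) + Im (f t) * Im m))%R
      by (unfold Re, Im; ring).
    apply (is_derive_minus (V := R_NormedModule)); now apply Derive.is_derive_mult.
  - replace (_ + _)%R with
      ((Re l * Im (g t) + Re (f t) * Im m) + (Im l * Re (g t) + Im (f t) * Re m))%R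
      by (unfold Re, Im; ring).
    apply (is_derive_plus (V := R_NormedModule)); now apply Derive.is_derive_mult.
Qed.

Lemma cderiv_ray (w : C) (t : R) : cderiv (fun s => RtoC s * w) t w.
Proof.
  apply (cderiv_eq _ _ (1 * w + RtoC t * 0)); [ring|].
  apply cderiv_mult; [apply cderiv_id | apply cderiv_const].
Qed.

Lemma cderiv_scal (f : R -> C) (t : R) (c l : C) :
  cderiv f t l -> cderiv (fun s => c * f s) t (c * l).
Proof.
  intros h; apply (cderiv_eq _ _ (0 * f t + c * l)); [ring|].
  apply cderiv_mult; [apply cderiv_const | exact h].
Qed.

Lemma cderiv_pow (f : R -> C) (t : R) (l : C) (n : nat) :
  cderiv f t l -> cderiv (fun s => f s ^ n) t (RtoC (INR n) * l * f t ^ Init.Nat.pred n).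
Proof.
  intros h; induction n as [|n IH].
  - apply (cderiv_eq _ _ (RtoC 0)).
    + simpl INR. now rewrite !Cmult_0_l.
    + exact (cderiv_const 1 t).
  - apply (cderiv_eq _ _ (l * f t ^ n + f t * (RtoC (INR n) * l * f t ^ Init.Nat.pred n))).
    + rewrite S_INR, RtoC_plus; destruct n as [|n]; simpl Cpow; simpl Init.Nat.pred.
      * simpl INR; ring.
      * ring.
    + exact (cderiv_mult _ _ _ _ _ h IH).
Qed.

Lemma cderiv_Cexp (f : R -> C) (t : R) (l : C) :
  cderiv f t l -> cderiv (fun s => Cexp (f s)) t (l * Cexp (f t)).
Proof.
  intros [h1 h2].
  assert (he : is_derive (fun s => exp (Re (f s))) t (Re l * exp (Re (f t)))%R)
    by exact (is_derive_comp exp _ t _ _ (is_derive_exp _) h1).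
  assert (hs : is_derive (fun s => sin (Im (f s))) t (Im l * cos (Im (f t)))%R)
    by exact (is_derive_comp sin _ t _ _ (is_derive_sin _) h2).
  assert (hc : is_derive (fun s => cos (Im (f s))) t (Im l * - sin (Im (f t)))%R)
    by exact (is_derive_comp cos _ t _ _ (is_derive_cos _) h2).
  split.
  - replace (Re (l * Cexp (f t))) with
      ((Re l * exp (Re (f t))) * cos (Im (f t)) + exp (Re (f t)) * (Im l * - sin (Im (f t))))%R
      by (simpl; unfold Re, Im; ring).
    exact (Derive.is_derive_mult _ _ _ _ _ he hc).
  - replace (Im (l * Cexp (f t))) with
      ((Re l * exp (Re (f t))) * sin (Im (f t)) + exp (Re (f t)) * (Im l * cos (Im (f t))))%R
      by (simpl; unfold Re, Im; ring).
    exact (Derive.is_derive_mult _ _ _ _ _ he hs).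
Qed.

(** * Integrals of complex functions of a real variable *)

Definition cint (f : R -> C) (a b : R) : C :=
  (RInt (fun t => Re (f t)) a b, RInt (fun t => Im (f t)) a b).

Lemma ccont_ex_RInt (f : R -> C) (a b : R) : ccont f ->
  ex_RInt (fun t => Re (f t)) a b /\ ex_RInt (fun t => Im (f t)) a b.
Proof.
  intros hf; split; apply (ex_RInt_continuous (V := R_CompleteNormedModule)); intros t _;
    [exact (proj1 (hf t)) | exact (proj2 (hf t))].
Qed.

Lemma is_RInt_cint (f : R -> C) (a b : R) : ccont f ->
  is_RInt (V := C_R_NormedModule) f a b (cint f a b).
Proof.
  intros hf; destruct (ccont_ex_RInt f a b hf) as [h1 h2].
  apply is_RInt_fct_extend_pair; apply (RInt_correct (V := R_CompleteNormedModule)); assumption.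
Qed.

Lemma is_RInt_cint_eq (f : R -> C) (a b : R) (l : C) :
  is_RInt (V := C_R_NormedModule) f a b l -> cint f a b = l.
Proof.
  intros h; apply C_eq; apply is_RInt_unique;
    [apply (is_RInt_fct_extend_fst _ _ _ _ h) | apply (is_RInt_fct_extend_snd _ _ _ _ h)].
Qed.

Lemma cint_ext (f g : R -> C) (a b : R) :
  (forall t, (Rmin a b < t < Rmax a b)%R -> f t = g t) -> cint f a b = cint g a b.
Proof.
  intros e; apply C_eq; apply RInt_ext; intros t ht; now rewrite e.
Qed.

Lemma cint_plus (f g : R -> C) (a b : R) : ccont f -> ccont g ->
  cint (fun t => f t + g t) a b = cint f a b + cint g a b.
Proof.
  intros hf hg; apply is_RInt_cint_eq.
  apply (is_RInt_plus (V := C_R_NormedModule) f g); now apply is_RInt_cint.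
Qed.

Lemma cint_scal (c : C) (f : R -> C) (a b : R) : ccont f ->
  cint (fun t => c * f t) a b = c * cint f a b.
Proof.
  intros hf; destruct (ccont_ex_RInt f a b hf) as [h1 h2].
  apply (RInt_correct (V := R_CompleteNormedModule)) in h1, h2.
  assert (h : forall (k : R) (g : R -> R) l,
    is_RInt g a b l -> is_RInt (fun t => k * g t)%R a b (k * l)%R)
    by (intros k g l; apply (is_RInt_scal (V := R_NormedModule))).
  apply C_eq; simpl; apply is_RInt_unique.
  - apply (is_RInt_minus (V := R_NormedModule) (fun t => fst c * Re (f t))%R
      (fun t => snd c * Im (f t))%R); now apply h.
  - apply (is_RInt_plus (V := R_NormedModule) (fun t => fst c * Im (f t))%R
      (fun t => snd c * Re (f t))%R); now apply h.
Qed.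

Lemma cint_Chasles (f : R -> C) (a b c : R) : ccont f ->
  cint f a b + cint f b c = cint f a c.
Proof.
  intros hf; symmetry; apply is_RInt_cint_eq.
  eapply (is_RInt_Chasles (V := C_R_NormedModule)); now apply is_RInt_cint.
Qed.

Lemma cint_shift (f : R -> C) (a b v : R) : ccont f ->
  cint (fun t => f (t + v)%R) a b = cint f (a + v) (b + v).
Proof.
  intros hf; apply is_RInt_cint_eq.
  apply (is_RInt_ext (V := C_R_NormedModule) (fun y => scal 1%R (f (1 * y + v)%R))).
  - intros x _; rewrite Rmult_1_l; exact (scal_one (V := C_R_NormedModule) _).
  - apply (is_RInt_comp_lin (V := C_R_NormedModule)).
    rewrite !Rmult_1_l; now apply is_RInt_cint.
Qed.

Lemma cint_FTC (f df : R -> C) (a b : R) :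
  (forall t, cderiv f t (df t)) -> ccont df -> cint df a b = f b - f a.
Proof.
  intros hd hc; apply C_eq; apply is_RInt_unique.
  - exact (is_RInt_derive (V := R_CompleteNormedModule) (fun t => Re (f t)) (fun t => Re (df t))
      a b (fun t _ => proj1 (hd t)) (fun t _ => proj1 (hc t))).
  - exact (is_RInt_derive (V := R_CompleteNormedModule) (fun t => Im (f t)) (fun t => Im (df t))
      a b (fun t _ => proj2 (hd t)) (fun t _ => proj2 (hc t))).
Qed.

Lemma cint_bound (f : R -> C) (G : R -> R) (a b : R) : (a <= b)%R -> ccont f ->
  (forall t, (a <= t <= b)%R -> (Cmod (f t) <= G t)%R) -> ex_RInt G a b ->
  (Cmod (cint f a b) <= RInt G a b)%R.
Proof.
  intros hab hf hG he.
  rewrite Cmod_norm.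
  apply (norm_RInt_le (V := C_R_NormedModule) f G a b).
  - exact hab.
  - intros x hx; rewrite <- Cmod_norm; auto.
  - now apply is_RInt_cint.
  - now apply (RInt_correct (V := R_CompleteNormedModule)).
Qed.

(** * Exponential integrals *)

Fixpoint csum (f : nat -> C) (m : nat) : C :=
  match m with O => 0 | S m => csum f m + f m end.

Lemma csum_ext (f g : nat -> C) (m : nat) : (forall k, f k = g k) -> csum f m = csum g m.
Proof. intros e; induction m; simpl; congruence. Qed.

Lemma csum_mult (c : C) (f : nat -> C) (m : nat) : c * csum f m = csum (fun k => c * f k) m.
Proof. induction m as [|m IH]; simpl; [|rewrite <- IH]; ring. Qed.

Lemma csum_plus (f g : nat -> C) (m : nat) :
  csum (fun k => f k + g k) m = csum f m + csum g m.
Proof. induction m as [|m IH]; simpl; [|rewrite IH]; ring. Qed.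

Lemma ccont_csum (f : nat -> R -> C) (m : nat) :
  (forall k, ccont (f k)) -> ccont (fun t => csum (fun k => f k t) m).
Proof.
  intros hf; induction m as [|m IH]; simpl; [apply ccont_const | now apply ccont_plus].
Qed.

Lemma cint_csum (f : nat -> R -> C) (a b : R) (m : nat) : (forall k, ccont (f k)) ->
  cint (fun t => csum (fun k => f k t) m) a b = csum (fun k => cint (f k) a b) m.
Proof.
  intros hf; induction m as [|m IH]; simpl.
  - replace (cint (fun _ => 0) a b) with (0 * cint (fun _ => 0) a b).
    + ring.
    + rewrite <- (cint_scal 0 (fun _ => 0)) by apply ccont_const.
      apply cint_ext; intros; ring.
  - rewrite (cint_plus (fun t => csum (fun k => f k t) m)) by (auto; now apply ccont_csum).
    now rewrite IH.
Qed.

Lemma RtoC_m1 : RtoC (-1) = - RtoC 1.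
Proof. now rewrite <- RtoC_opp. Qed.

(** * Taylor remainder of the exponential *)

Definition exp_trunc (w : C) (m : nat) : C :=
  csum (fun k => RtoC (/ INR (fact k)) * w ^ k) m.

Lemma cderiv_exp_trunc (w : C) (m : nat) (t : R) :
  cderiv (fun s => exp_trunc (RtoC s * w) (S m)) t (w * exp_trunc (RtoC t * w) m).
Proof.
  pose proof (cderiv_ray w t) as hl.
  induction m as [|m IH].
  - apply (cderiv_eq _ _ 0); [unfold exp_trunc; simpl csum; ring|].
    apply (cderiv_ext (fun _ => 1)); [|apply cderiv_const].
    intro s; unfold exp_trunc; simpl csum; simpl fact; simpl INR.
    rewrite Rinv_1; simpl Cpow; ring.
  - apply (cderiv_eq _ _ (w * exp_trunc (RtoC t * w) m
      + RtoC (/ INR (fact (S m))) * (RtoC (INR (S m)) * w * (RtoC t * w) ^ m))).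
    + unfold exp_trunc; simpl csum.
      replace (/ INR (fact m))%R with (/ INR (fact (S m)) * INR (S m))%R.
      * rewrite RtoC_mult; ring.
      * rewrite fact_simpl, mult_INR; field; split;
          [apply INR_fact_neq_0 | apply not_0_INR; lia].
    + apply (cderiv_plus (fun s => exp_trunc (RtoC s * w) (S m))
        (fun s => RtoC (/ INR (fact (S m))) * (RtoC s * w) ^ S m)); [exact IH|].
      apply (cderiv_scal (fun s => (RtoC s * w) ^ S m)).
      exact (cderiv_pow (fun s => RtoC s * w) t w (S m) hl).
Qed.

Lemma exp_trunc_0 (m : nat) : exp_trunc 0 (S m) = 1.
Proof.
  induction m as [|m IH].
  - unfold exp_trunc; simpl csum; simpl fact; simpl INR.
    rewrite Rinv_1; simpl Cpow; ring.
  - change (exp_trunc 0 (S (S m))) with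
      (exp_trunc 0 (S m) + RtoC (/ INR (fact (S m))) * 0 ^ S m).
    rewrite IH; simpl Cpow; ring.
Qed.

Lemma ccont_exp_trunc (f : R -> C) (m : nat) :
  ccont f -> ccont (fun t => exp_trunc (f t) m).
Proof.
  intros hf; unfold exp_trunc. apply (ccont_csum (fun k t => RtoC (/ INR (fact k)) * f t ^ k)).
  intro k; apply ccont_mult; [apply ccont_const | now apply ccont_pow].
Qed.

(** The remainder of order [m + 1] at [w] is the integral over [0, 1] of [w] times the remainder of
    order [m] at [t w]. The inductive bound contributes [t ^ m], whose integral 1/(m+1) supplies the
    next factor of the factorial. *)
Lemma Cexp_trunc_bound (m : nat) : forall w : C,
  (Cmod (Cexp w - exp_trunc w m) <= Cmod w ^ m * exp (Cmod w) / INR (fact m))%R.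
Proof.
  induction m as [|m IH]; intro w.
  - unfold exp_trunc; simpl csum; simpl fact; simpl INR.
    replace (Cexp w - 0) with (Cexp w) by ring.
    simpl pow; unfold Rdiv; rewrite Rinv_1, Rmult_1_r, Rmult_1_l; apply Cmod_Cexp_le.
  - set (f := fun t : R => Cexp (RtoC t * w) - exp_trunc (RtoC t * w) (S m)).
    set (df := fun t : R => w * (Cexp (RtoC t * w) - exp_trunc (RtoC t * w) m)).
    assert (hcl : ccont (fun t : R => RtoC t * w)).
    { apply ccont_mult; [apply ccont_RtoC; intro; apply continuous_id | apply ccont_const]. }
    assert (hc : ccont df).
    { apply ccont_mult; [apply ccont_const|].
      apply (ccont_plus (fun t => Cexp (RtoC t * w)));
        [now apply ccont_Cexp | now apply ccont_opp, ccont_exp_trunc]. }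
    assert (hF : cint df 0 1 = f 1%R - f 0%R).
    { apply cint_FTC; [|exact hc]. intro t; unfold f, df.
      pose proof (cderiv_ray w t) as hl.
      apply (cderiv_ext (fun s => Cexp (RtoC s * w) + RtoC (-1) * exp_trunc (RtoC s * w) (S m))).
      { intro s; rewrite RtoC_m1; ring. }
      apply (cderiv_eq _ _ (w * Cexp (RtoC t * w)
        + RtoC (-1) * (w * exp_trunc (RtoC t * w) m))).
      { rewrite RtoC_m1; ring. }
      apply cderiv_plus; [now apply cderiv_Cexp | apply cderiv_scal, cderiv_exp_trunc]. }
    assert (h0 : f 0%R = 0).
    { unfold f; replace (RtoC 0 * w) with (RtoC 0) by ring.
      rewrite exp_trunc_0, Cexp_0; ring. }
    assert (h1 : f 1%R = Cexp w - exp_trunc w (S m)).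
    { unfold f; now replace (RtoC 1 * w) with w by ring. }
    rewrite h0, h1 in hF.
    replace (Cexp w - exp_trunc w (S m)) with (cint df 0 1) by (rewrite hF; ring).
    set (K := (Cmod w ^ S m * exp (Cmod w) / INR (fact m))%R).
    assert (hI : is_RInt (fun t => K * t ^ m)%R 0 1 (K / INR (S m))%R).
    { replace (K / INR (S m))%R with
        (minus (K / INR (S m) * 1 ^ S m) (K / INR (S m) * 0 ^ S m))%R
        by (rewrite pow1, pow_i by lia; unfold minus, plus, opp; simpl; ring).
      apply (is_RInt_derive (V := R_CompleteNormedModule) (fun t => K / INR (S m) * t ^ S m)%R).
      - intros x _; auto_derive; [auto|].
        replace (match m with 0%nat => 1 | S _ => INR m + 1 end)%R with (INR (S m)) by reflexivity.
        field; apply not_0_INR; lia.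
      - intros x _; apply (ex_derive_continuous (K := R_AbsRing) (V := R_NormedModule)).
        auto_derive; auto. }
    eapply Rle_trans.
    + apply (cint_bound df (fun t => K * t ^ m)%R); [lra | exact hc | | now exists (K / INR (S m))%R].
      intros t ht; unfold df, K. rewrite Cmod_mult.
      assert (hm : Cmod (RtoC t * w) = (t * Cmod w)%R)
        by (rewrite Cmod_mult, Cmod_R, Rabs_pos_eq by lra; reflexivity).
      pose proof (Cmod_ge_0 w) as hw.
      replace (Cmod w ^ S m * exp (Cmod w) / INR (fact m) * t ^ m)%R with
        (Cmod w * ((t * Cmod w) ^ m * exp (Cmod w) / INR (fact m)))%R
        by (rewrite Rpow_mult_distr; simpl; field; apply INR_fact_neq_0).
      apply Rmult_le_compat_l; [exact hw|].
      eapply Rle_trans; [apply IH|]. rewrite hm.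
      unfold Rdiv; apply Rmult_le_compat_r.
      { apply Rlt_le, Rinv_0_lt_compat, INR_fact_lt_0. }
      apply Rmult_le_compat_l; [apply pow_le; nra|].
      apply exp_le; nra.
    + rewrite (is_RInt_unique _ _ _ _ hI); apply Req_le; unfold K.
      rewrite fact_simpl, mult_INR; field; split;
        [apply INR_fact_neq_0 | apply not_0_INR; lia].
Qed.

Lemma continuous_Cmod (f : R -> C) (t : R) : ccont f -> continuous (fun s => Cmod (f s)) t.
Proof.
  intros hf; destruct (hf t) as [h1 h2]. unfold Cmod.
  assert (hsq : forall p : R -> R, continuous p t -> continuous (fun s => p s ^ 2)%R t).
  { intros p hp; apply (continuous_comp p (fun x => x ^ 2)%R); [exact hp|].
    apply (ex_derive_continuous (K := R_AbsRing) (V := R_NormedModule)); auto_derive; auto. }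
  apply (continuous_comp (fun s => fst (f s) ^ 2 + snd (f s) ^ 2)%R sqrt).
  - exact (continuous_plus (V := R_NormedModule) _ _ _ (hsq _ h1) (hsq _ h2)).
  - apply continuous_sqrt.
Qed.

(* Taylor's formula for [F n] in terms of [F (n+1)], [F (n+2)], ...: order 2 makes
   [F (S n)] the derivative of [F n], and at [z = 0] all orders give the Taylor series. *)
Definition tame (F : nat -> C -> C) : Prop :=
  exists K : R, (0 <= K)%R /\ forall (n m : nat) (z h : C),
    (Cmod (F n (z + h)%C - csum (fun k => RtoC (/ INR (fact k)) * h ^ k * F (n + k)%nat z)%C m)
     <= K * exp (Cmod z) * (Cmod h ^ m * exp (Cmod h) / INR (fact m)))%R.

Lemma tame_plus (F G : nat -> C -> C) :
  tame F -> tame G -> tame (fun n z => F n z + G n z).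
Proof.
  intros [K [hK hF]] [L [hL hG]]; exists (K + L)%R; split; [lra|]; intros n m z h.
  specialize (hF n m z h); specialize (hG n m z h).
  rewrite (csum_ext _ (fun k : nat => RtoC (/ INR (fact k)) * h ^ k * F (n + k)%nat z
    + RtoC (/ INR (fact k)) * h ^ k * G (n + k)%nat z)) by (intro; ring).
  rewrite csum_plus. unfold Cminus in *.
  eapply Rle_trans; [|rewrite 2!Rmult_plus_distr_r; exact (Rplus_le_compat _ _ _ _ hF hG)].
  eapply Rle_trans; [|apply Cmod_triangle]. apply Req_le; f_equal; ring.
Qed.

Lemma tame_scal (c : C) (F : nat -> C -> C) : tame F -> tame (fun n z => c * F n z).
Proof.
  intros [K [hK hF]]; exists (Cmod c * K)%R; split.
  { apply Rmult_le_pos; [apply Cmod_ge_0 | exact hK]. }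
  intros n m z h.
  rewrite (csum_ext _ (fun k => c * (RtoC (/ INR (fact k)) * h ^ k * F (n + k)%nat z)))
    by (intro; ring).
  rewrite <- csum_mult.
  replace (c * F n (z + h) - _) with
    (c * (F n (z + h) - csum (fun k => RtoC (/ INR (fact k)) * h ^ k * F (n + k)%nat z) m))
    by ring.
  rewrite Cmod_mult, 2!(Rmult_assoc (Cmod c)).
  apply Rmult_le_compat_l; [apply Cmod_ge_0 | apply hF].
Qed.

Definition expint (g u : R -> C) (a b : R) (n : nat) (z : C) : C :=
  cint (fun t => g t * u t ^ n * Cexp (z * u t)) a b.

Lemma ccont_expint (g u : R -> C) (n : nat) (z : C) :
  ccont g -> ccont u -> ccont (fun t => g t * u t ^ n * Cexp (z * u t)).
Proof.
  intros hg hu; apply ccont_mult.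
  - apply ccont_mult; [exact hg | now apply ccont_pow].
  - apply ccont_Cexp, ccont_mult; [apply ccont_const | exact hu].
Qed.

Lemma pow_le_1 (x : R) (n : nat) : (0 <= x <= 1)%R -> (x ^ n <= 1)%R.
Proof. intros h; rewrite <- (pow1 n); apply pow_incr; exact h. Qed.

(** Under the integral, the Taylor remainder of e^((z+h)u) is e^(zu) times the remainder of e^(hu).
    Since |u| <= 1, the powers [u t ^ n] cost nothing, so the integral of |g| serves as one constant
    for all [n]. *)
Lemma tame_expint (g u : R -> C) (a b : R) : (a <= b)%R -> ccont g -> ccont u ->
  (forall t, (a <= t <= b)%R -> (Cmod (u t) <= 1)%R) -> tame (expint g u a b).
Proof.
  intros hab hg hu hu1.
  assert (hex : ex_RInt (fun t => Cmod (g t)) a b).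
  { apply (ex_RInt_continuous (V := R_CompleteNormedModule)).
    intros t _; now apply continuous_Cmod. }
  exists (RInt (fun t => Cmod (g t)) a b); split.
  { apply RInt_ge_0; auto; intros; apply Cmod_ge_0. }
  intros n m z h.
  set (B := (Cmod h ^ m * exp (Cmod h) / INR (fact m))%R).
  set (f := fun t => g t * u t ^ n * Cexp (z * u t) * (Cexp (h * u t) - exp_trunc (h * u t) m)).
  assert (hf : ccont f).
  { apply ccont_mult; [now apply ccont_expint|].
    assert (ccont (fun t => h * u t)) by (apply ccont_mult; [apply ccont_const | exact hu]).
    apply (ccont_plus (fun t => Cexp (h * u t))); [now apply ccont_Cexp|].
    now apply ccont_opp, ccont_exp_trunc. }
  replace (expint g u a b n (z + h) - _) with (cint f a b).
  - eapply Rle_trans.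
    + apply (cint_bound f (fun t => Cmod (g t) * (exp (Cmod z) * B))%R); auto.
      * intros t ht; unfold f. rewrite !Cmod_mult, Cmod_pow.
        specialize (hu1 t ht). pose proof (Cmod_ge_0 (u t)) as hu0.
        pose proof (Cmod_ge_0 (g t)) as hg0.
        pose proof (Cmod_ge_0 z) as hz0. pose proof (Cmod_ge_0 h) as hh0.
        rewrite Rmult_assoc. apply Rmult_le_compat.
        -- apply Rmult_le_pos; [exact hg0 | now apply pow_le].
        -- apply Rmult_le_pos; apply Cmod_ge_0.
        -- rewrite <- (Rmult_1_r (Cmod (g t))) at 2.
           apply Rmult_le_compat_l; [exact hg0 | now apply pow_le_1].
        -- apply Rmult_le_compat; try apply Cmod_ge_0.
           ++ eapply Rle_trans; [apply Cmod_Cexp_le|].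
              apply exp_le; rewrite Cmod_mult; nra.
           ++ eapply Rle_trans; [apply Cexp_trunc_bound|].
              unfold B; rewrite Cmod_mult. unfold Rdiv; apply Rmult_le_compat_r.
              { apply Rlt_le, Rinv_0_lt_compat, INR_fact_lt_0. }
              apply Rmult_le_compat.
              { apply pow_le; nra. }
              { apply Rlt_le, exp_pos. }
              { apply pow_incr; nra. }
              { apply exp_le; nra. }
      * apply (ex_RInt_ext (fun t => scal (exp (Cmod z) * B)%R (Cmod (g t)))).
        { intros; unfold scal; simpl; unfold mult; simpl; ring. }
        now apply (ex_RInt_scal (V := R_NormedModule)).
    + rewrite (RInt_ext _ (fun t => scal (exp (Cmod z) * B)%R (Cmod (g t)))).
      2:{ intros; unfold scal; simpl; unfold mult; simpl; ring. }
      rewrite (RInt_scal (V := R_CompleteNormedModule)) by exact hex.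
      unfold scal; simpl; unfold mult; simpl; apply Req_le; ring.
  - unfold expint.
    rewrite (csum_ext _ (fun k => cint (fun t => RtoC (/ INR (fact k)) * h ^ k
      * (g t * u t ^ (n + k) * Cexp (z * u t))) a b))
      by (intro k; rewrite cint_scal; [reflexivity | now apply ccont_expint]).
    assert (hk : forall k, ccont (fun t => RtoC (/ INR (fact k)) * h ^ k
      * (g t * u t ^ (n + k) * Cexp (z * u t)))).
    { intro k; apply ccont_mult; [apply ccont_const | now apply ccont_expint]. }
    rewrite <- (cint_csum (fun k t => RtoC (/ INR (fact k)) * h ^ k
      * (g t * u t ^ (n + k) * Cexp (z * u t)))) by exact hk.
    set (S1 := fun t => csum _ m).
    replace (cint f a b) with (cint (fun t => g t * u t ^ n * Cexp ((z + h) * u t)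
      + RtoC (-1) * S1 t) a b).
    + assert (hS : ccont S1) by (apply (ccont_csum (fun k t => RtoC (/ INR (fact k)) * h ^ k
        * (g t * u t ^ (n + k) * Cexp (z * u t)))); exact hk).
      rewrite cint_plus, cint_scal.
      * rewrite RtoC_m1; ring.
      * exact hS.
      * now apply ccont_expint.
      * apply ccont_mult; [apply ccont_const | exact hS].
    + apply cint_ext; intros t _; unfold f, S1, exp_trunc.
      rewrite (csum_ext _ (fun k => g t * u t ^ n * Cexp (z * u t)
        * (RtoC (/ INR (fact k)) * (h * u t) ^ k))).
      * rewrite <- csum_mult, Cmult_plus_distr_r, Cexp_plus, RtoC_m1; ring.
      * intro k; rewrite Cpow_add_r, Cpow_mult_l; ring.
Qed.

(** The remainder of order 2 is O(|h|^2) near h = 0, so the linear term [h * F (S n) z] is the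
    differential. *)
Lemma tame_deriv (F : nat -> C -> C) (n : nat) : tame F -> is_C_derivative (F n) (F (S n)).
Proof.
  intros [K [hK hF]] z.
  split; [apply (is_linear_scal_l (K := C_AbsRing) (V := C_NormedModule))|].
  intros y hy eps.
  apply (is_filter_lim_locally_unique (K := C_AbsRing) (V := AbsRing_NormedModule C_AbsRing)) in hy; subst y.
  set (L := (K * exp (Cmod z) * exp 1)%R).
  assert (hL : (0 <= L)%R).
  { unfold L; pose proof (exp_pos (Cmod z)); pose proof (exp_pos 1).
    repeat apply Rmult_le_pos; lra. }
  (* The 1 keeps [exp (Cmod h)] below [exp 1]; dividing by [L + 1] instead of [L] allows [L = 0]. *)
  assert (hd : (0 < Rmin 1 (eps / (L + 1)))%R).
  { apply Rmin_case; [lra|]; apply Rdiv_lt_0_compat; [apply cond_pos | lra]. }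
  apply (locally_le_locally_norm (K := C_AbsRing) (V := AbsRing_NormedModule C_AbsRing)).
  exists (mkposreal _ hd); intros y hy.
  unfold ball_norm in hy; simpl in hy.
  change (Cmod (y - z) < Rmin 1 (eps / (L + 1)))%R in hy.
  change (Cmod (F n y - F n z - (y - z) * F (S n) z) <= eps * Cmod (y - z))%R.
  set (h := y - z) in *.
  replace y with (z + h) by (unfold h; ring).
  specialize (hF n 2%nat z h); simpl csum in hF; simpl fact in hF; simpl INR in hF.
  rewrite Nat.add_0_r, Nat.add_1_r, Rinv_1 in hF.
  replace (F n (z + h) - F n z - h * F (S n) z) with
    (F n (z + h) - (0 + 1 * h ^ 0 * F n z + 1 * h ^ 1 * F (S n) z)) by (simpl; ring).
  eapply Rle_trans; [exact hF|].
  pose proof (Rmin_l 1 (eps / (L + 1))); pose proof (Rmin_r 1 (eps / (L + 1))).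
  pose proof (Cmod_ge_0 h) as h0.
  assert (he : (exp (Cmod h) <= exp 1)%R) by (apply exp_le; lra).
  pose proof (exp_pos (Cmod h)). pose proof (exp_pos (Cmod z)).
  assert (hLh : (L * Cmod h <= eps)%R).
  { apply Rle_trans with ((L + 1) * (eps / (L + 1)))%R; [|apply Req_le; field; lra].
    apply Rmult_le_compat; lra. }
  apply Rle_trans with (L * Cmod h * Cmod h)%R; [|apply Rmult_le_compat_r; lra].
  unfold L. simpl pow.
  replace (K * exp (Cmod z) * exp 1 * Cmod h * Cmod h)%R with
    ((K * exp (Cmod z) * (Cmod h * Cmod h)) * exp 1)%R by ring.
  replace (K * exp (Cmod z) * (Cmod h * (Cmod h * 1) * exp (Cmod h) / (1 + 1)))%R with
    ((K * exp (Cmod z) * (Cmod h * Cmod h)) * (exp (Cmod h) / 2))%R by field.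
  apply Rmult_le_compat_l; [|lra].
  repeat apply Rmult_le_pos; lra.
Qed.

(** * Growth from the recurrence *)

Definition moment_recurrence (F : nat -> C -> C) : Prop := forall (n : nat) (z : C),
  F (4 + n)%nat z - z * F (3 + n)%nat z - RtoC (INR n) * F (2 + n)%nat z - F n z = 0.

(* The recurrence [n a_(n+2) = a_(n+4) - a_n] of the Taylor coefficients at 0 is
   read downwards: mere boundedness selects its factorially decaying solutions. *)
Lemma coef_decay (F : nat -> C -> C) : tame F -> moment_recurrence F ->
  exists K : R, (0 <= K)%R /\ (forall n, (Cmod (F n (RtoC 0)) <= K)%R) /\
    forall k n, (2 * k + 2 <= n)%nat -> (Cmod (F n (RtoC 0)) <= K / INR (fact k))%R.
Proof.
  intros [K [hK hF]] hrec.
  assert (hb : forall n, (Cmod (F n (RtoC 0)) <= K)%R).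
  { intro n; specialize (hF n 0%nat (RtoC 0) (RtoC 0)).
    simpl csum in hF; simpl fact in hF; simpl pow in hF; simpl INR in hF.
    rewrite Cmod_0, exp_0 in hF.
    replace (F n (0 + 0) - 0) with (F n 0) in hF
      by (replace (0 + 0) with (RtoC 0) by ring; ring).
    lra. }
  exists K; split; [exact hK | split; [exact hb|]].
  induction k as [|k IH]; intros n hn.
  - simpl fact; simpl INR; unfold Rdiv; rewrite Rinv_1, Rmult_1_r; apply hb.
  - destruct n as [|[|n]]; try lia.
    assert (h1 : (Cmod (F (4 + n)%nat (RtoC 0)) <= K / INR (fact k))%R) by (apply IH; lia).
    assert (h2 : (Cmod (F n (RtoC 0)) <= K / INR (fact k))%R) by (apply IH; lia).
    (* The two neighbours [F (4 + n)] and [F n] cost a factor 2, and dividing by [n >= 2 (k + 1)]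
       leaves exactly the gain 1/(k+1). Hence one factor of the factorial for every two indices. *)
    assert (hk : (INR (2 * (k + 1)) <= INR n)%R) by (apply le_INR; lia).
    rewrite mult_INR, plus_INR in hk; simpl INR in hk.
    pose proof (pos_INR k) as hk0.
    assert (he : RtoC (INR n) * F (2 + n)%nat (RtoC 0) = F (4 + n)%nat (RtoC 0) - F n (RtoC 0)).
    { pose proof (hrec n (RtoC 0)) as h.
      replace (F (4 + n)%nat (RtoC 0) - F n (RtoC 0)) with
        (RtoC (INR n) * F (2 + n)%nat (RtoC 0) + (F (4 + n)%nat (RtoC 0) - RtoC 0 * F (3 + n)%nat (RtoC 0)
         - RtoC (INR n) * F (2 + n)%nat (RtoC 0) - F n (RtoC 0))) by ring.
      rewrite h; ring. }
    apply (f_equal Cmod) in he.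
    rewrite Cmod_mult, Cmod_R, Rabs_pos_eq in he by lra.
    assert (h3 : (Cmod (F (4 + n)%nat (RtoC 0) - F n (RtoC 0)) <= 2 * (K / INR (fact k)))%R).
    { unfold Cminus; eapply Rle_trans; [apply Cmod_triangle|]. rewrite Cmod_opp; lra. }
    change (S (S n)) with (2 + n)%nat.
    pose proof (INR_fact_lt_0 k).
    assert (h4 : (K / INR (fact (S k)) = (K / INR (fact k)) / (INR k + 1))%R).
    { rewrite fact_simpl, mult_INR, S_INR; field; split; lra. }
    rewrite h4. apply (Rmult_le_reg_l (2 * (INR k + 1))%R); [lra|].
    apply Rle_trans with (2 * (K / INR (fact k)))%R; [|apply Req_le; field; split; lra].
    rewrite <- he in h3. eapply Rle_trans; [|exact h3].
    apply Rmult_le_compat_r; [apply Cmod_ge_0 | lra].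
Qed.

Lemma exp_ge_term (y : R) (n : nat) : (0 <= y)%R -> (y ^ n / INR (fact n) <= exp y)%R.
Proof.
  intros hy; eapply Rle_trans; [|apply (exp_ge_taylor y n hy)].
  assert (h : forall k, (0 <= y ^ k / INR (fact k))%R).
  { intro k; apply Rmult_le_pos; [now apply pow_le|].
    apply Rlt_le, Rinv_0_lt_compat, INR_fact_lt_0. }
  destruct n as [|n]; [right; reflexivity|].
  rewrite tech5. pose proof (cond_pos_sum _ n h); lra.
Qed.

(** The error [r ^ m / m!] tends to 0. Asking only for arbitrarily large [m] leaves the choice of
    truncation orders free, for instance even ones. *)
Lemma le_of_le_plus_pow_fact (X B K r : R) :
  (forall m0, exists m, (m0 <= m)%nat /\ (X <= B + K * (r ^ m / INR (fact m)))%R) -> (X <= B)%R.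
Proof.
  intros h; apply le_epsilon; intros eps heps.
  assert (hp : (0 < eps / (Rabs K + 1))%R).
  { apply Rdiv_lt_0_compat; [lra|]; pose proof (Rabs_pos K); lra. }
  destruct (cv_speed_pow_fact r _ hp) as [N hN].
  destruct (h N) as [m [hm hX]].
  specialize (hN m hm). unfold R_dist in hN; rewrite Rminus_0_r in hN.
  eapply Rle_trans; [exact hX|]. apply Rplus_le_compat_l.
  eapply Rle_trans; [apply Rle_abs|]. rewrite Rabs_mult.
  pose proof (Rabs_pos K).
  apply Rle_trans with ((Rabs K + 1) * (eps / (Rabs K + 1)))%R; [|right; field; lra].
  apply Rmult_le_compat; try apply Rabs_pos; lra.
Qed.

Lemma tame_taylor (F : nat -> C -> C) : tame F -> exists K : R, forall (z : C) (m : nat),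
  (Cmod (F 0%nat z - csum (fun k => RtoC (/ INR (fact k)) * z ^ k * F k (RtoC 0))%C m)
   <= K * exp (Cmod z) * (Cmod z ^ m / INR (fact m)))%R.
Proof.
  intros [K [hK hF]]; exists K; intros z m.
  specialize (hF 0%nat m (RtoC 0) z). rewrite Cmod_0, exp_0, Rmult_1_r in hF.
  replace (RtoC 0 + z) with z in hF by ring.
  eapply Rle_trans; [exact hF|]. right; unfold Rdiv; ring.
Qed.

(* With [y = |z|^(2/3)], the terms of degree [2k+2] and [2k+3] are at most
   [K (1+r) r^2 (y^k / k!) (y^(2k) / (2k)!)], and the last factor is at most [exp y]. *)
Lemma partial_sum_bound (a : nat -> C) (K y : R) (z : C) (N : nat) : (0 <= K)%R -> (0 <= y)%R ->
  (y ^ 3 = Cmod z ^ 2)%R -> (forall n, (Cmod (a n) <= K)%R) ->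
  (forall k n, (2 * k + 2 <= n)%nat -> (Cmod (a n) <= K / INR (fact k))%R) ->
  (Cmod (csum (fun k => RtoC (/ INR (fact k)) * z ^ k * a k)%C (2 * (N + 2)))
   <= K * (1 + Cmod z) + K * (1 + Cmod z) * Cmod z ^ 2 * exp y
      * sum_f_R0 (fun k => y ^ k / INR (fact k)) N)%R.
Proof.
  intros hK hy hyz ha hd. set (r := Cmod z) in *.
  assert (hr : (0 <= r)%R) by apply Cmod_ge_0.
  set (T := fun k => (K * (1 + r) * r ^ 2 * exp y * (y ^ k / INR (fact k)))%R).
  assert (hT : forall k,
    (Cmod (RtoC (/ INR (fact (2 * k + 2))) * z ^ (2 * k + 2) * a (2 * k + 2)%nat) +
     Cmod (RtoC (/ INR (fact (2 * k + 3))) * z ^ (2 * k + 3) * a (2 * k + 3)%nat) <= T k)%R).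
  { intro k.
    set (W := (r ^ 2 * (y ^ k * y ^ (2 * k) / INR (fact (2 * k))) * (K / INR (fact k)))%R).
    assert (hy3 : (r ^ (2 * k) = y ^ k * y ^ (2 * k))%R).
    { rewrite pow_mult, <- hyz, <- pow_mult, <- pow_add; f_equal; lia. }
    assert (hW : forall n, (2 * k <= n)%nat -> forall j,
      (/ INR (fact n) * (r ^ (2 * k) * r ^ 2 * r ^ j) * (K / INR (fact k)) <= W * r ^ j)%R).
    { intros n hn j. unfold W. rewrite hy3.
      assert (hf : (/ INR (fact n) <= / INR (fact (2 * k)))%R).
      { apply Rinv_le_contravar; [apply INR_fact_lt_0|]. apply le_INR, fact_le, hn. }
      replace (r ^ 2 * (y ^ k * y ^ (2 * k) / INR (fact (2 * k))) * (K / INR (fact k)) * r ^ j)%R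
        with (/ INR (fact (2 * k)) * (y ^ k * y ^ (2 * k) * r ^ 2 * r ^ j) * (K / INR (fact k)))%R
        by (unfold Rdiv; ring).
      apply Rmult_le_compat_r.
      { apply Rmult_le_pos; [exact hK | apply Rlt_le, Rinv_0_lt_compat, INR_fact_lt_0]. }
      apply Rmult_le_compat_r; [|exact hf].
      repeat apply Rmult_le_pos; try apply pow_le; try lra; assumption. }
    assert (hterm : forall n, (2 * k + 2 <= n)%nat ->
      (Cmod (RtoC (/ INR (fact n)) * z ^ n * a n)
       <= / INR (fact n) * r ^ n * (K / INR (fact k)))%R).
    { intros n hn. pose proof (Rinv_0_lt_compat _ (INR_fact_lt_0 n)).
      rewrite !Cmod_mult, Cmod_R, Cmod_pow, Rabs_pos_eq by lra.
      apply Rmult_le_compat_l; [|now apply hd].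
      apply Rmult_le_pos; [lra | now apply pow_le]. }
    pose proof (hterm (2 * k + 2)%nat ltac:(lia)) as h1.
    pose proof (hterm (2 * k + 3)%nat ltac:(lia)) as h2.
    pose proof (hW (2 * k + 2)%nat ltac:(lia) 0%nat) as h3.
    pose proof (hW (2 * k + 3)%nat ltac:(lia) 1%nat) as h4.
    rewrite <- !pow_add in h3, h4.
    replace (2 * k + 2 + 0)%nat with (2 * k + 2)%nat in h3 by lia.
    replace (2 * k + 2 + 1)%nat with (2 * k + 3)%nat in h4 by lia.
    simpl (r ^ 0)%R in h3; simpl (r ^ 1)%R in h4.
    assert (h5 : (W * (1 + r) <= T k)%R).
    { unfold T, W.
      replace (r ^ 2 * (y ^ k * y ^ (2 * k) / INR (fact (2 * k))) * (K / INR (fact k)) * (1 + r))%R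
        with ((K * (1 + r) * r ^ 2 * (y ^ k / INR (fact k))) * (y ^ (2 * k) / INR (fact (2 * k))))%R
        by (unfold Rdiv; ring).
      replace (K * (1 + r) * r ^ 2 * exp y * (y ^ k / INR (fact k)))%R with
        ((K * (1 + r) * r ^ 2 * (y ^ k / INR (fact k))) * exp y)%R by ring.
      apply Rmult_le_compat_l; [|now apply exp_ge_term].
      repeat apply Rmult_le_pos; try apply pow_le; try lra.
      apply Rlt_le, Rinv_0_lt_compat, INR_fact_lt_0. }
    lra. }
  assert (hsum : (K * (1 + r) * r ^ 2 * exp y * sum_f_R0 (fun k => y ^ k / INR (fact k)) N
    = sum_f_R0 T N)%R) by (unfold T; rewrite scal_sum; apply sum_eq; intros; ring).
  rewrite hsum; clear hsum.
  (* The decay estimate starts at index 2, so degrees 0 and 1 use plain boundedness. The remaining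
     degrees up to [2N + 3] form the pairs k = 0, ..., N. *)
  assert (h0 : (Cmod (RtoC (/ INR (fact 0)) * z ^ 0 * a 0%nat) +
     Cmod (RtoC (/ INR (fact 1)) * z ^ 1 * a 1%nat) <= K * (1 + r))%R).
  { simpl fact; simpl INR; rewrite Rinv_1, !Cmod_mult, !Cmod_pow, Cmod_1.
    fold r; simpl pow. pose proof (ha 0%nat); pose proof (ha 1%nat).
    pose proof (Cmod_ge_0 (a 1%nat)). nra. }
  set (c := fun k => RtoC (/ INR (fact k)) * z ^ k * a k).
  change (Cmod (c 0%nat) + Cmod (c 1%nat) <= K * (1 + r))%R in h0.
  assert (hstep : forall n, (Cmod (csum c (S (S n)))
    <= Cmod (csum c n) + (Cmod (c n) + Cmod (c (S n))))%R).
  { intro n; simpl csum.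
    pose proof (Cmod_triangle (csum c n + c n) (c (S n))).
    pose proof (Cmod_triangle (csum c n) (c n)); lra. }
  assert (hTc : forall k, (Cmod (c (2 * k + 2)%nat) + Cmod (c (S (2 * k + 2))) <= T k)%R).
  { intro k; replace (S (2 * k + 2)) with (2 * k + 3)%nat by lia; apply hT. }
  induction N as [|N IH].
  - pose proof (hstep 2%nat) as h1; pose proof (hstep 0%nat) as h2.
    pose proof (hTc 0%nat) as h3. simpl csum in h2 at 2. rewrite Cmod_0 in h2.
    change (2 * (0 + 2))%nat with 4%nat; change (2 * 0 + 2)%nat with 2%nat in h3.
    change (sum_f_R0 T 0) with (T 0%nat). lra.
  - replace (2 * (S N + 2))%nat with (S (S (2 * (S N) + 2))) by lia.
    pose proof (hstep (2 * S N + 2)%nat) as h1. pose proof (hTc (S N)) as h2.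
    replace (2 * S N + 2)%nat with (2 * (N + 2))%nat in h1 at 2 by lia.
    rewrite tech5. lra.
Qed.

(** The exponent 3y, with y = |z|^(2/3), consists of one y from the factor [y^(2k) / (2k)!], one
    from the sum of [y^k / k!], and one that absorbs the polynomial factor. *)
Lemma growth_bound (F : nat -> C -> C) : tame F -> moment_recurrence F ->
  exists A : R, (0 < A)%R /\ forall z : C, (1 <= Cmod z)%R ->
    (Cmod (F 0%nat z) <= A * exp (3 * Rpower (Cmod z) (2 / 3)))%R.
Proof.
  intros hF hrec.
  destruct (coef_decay F hF hrec) as [K [hK [ha hd]]].
  destruct (tame_taylor F hF) as [L hL].
  (* By r <= y^2 and r^2 = y^3 the polynomial factors are at most 4 K y^5, and y^5 <= 5! e^y, whence
     480 = 4 * 120. The 1 keeps the constant positive when [K = 0]. *)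
  exists (480 * K + 1)%R; split; [lra|]. intros z hz.
  set (r := Cmod z) in *. set (y := Rpower r (2 / 3)).
  assert (hy3 : (y ^ 3 = r ^ 2)%R).
  { unfold y; rewrite <- !Rpower_pow by (try apply exp_pos; lra).
    rewrite Rpower_mult; f_equal; simpl; field. }
  assert (hy1 : (1 <= y)%R).
  { unfold y; rewrite <- (Rpower_O r) by lra. apply Rle_Rpower; lra. }
  set (B := (K * (1 + r) + K * (1 + r) * r ^ 2 * exp y * exp y)%R).
  assert (hB : (Cmod (F 0%nat z) <= B)%R).
  { apply (le_of_le_plus_pow_fact _ _ (L * exp r) r). intro N.
    exists (2 * (N + 2))%nat; split; [lia|].
    pose proof (hL z (2 * (N + 2))%nat) as h1.
    pose proof (partial_sum_bound (fun n => F n (RtoC 0)) K y z N hK ltac:(lra) hy3 ha hd) as h2.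
    simpl in h2.
    set (s := csum _ _) in h1, h2. fold r in h1, h2.
    assert (h3 : (sum_f_R0 (fun k => y ^ k / INR (fact k)) N <= exp y)%R)
      by (apply exp_ge_taylor; lra).
    assert (h4 : (Cmod (F 0%nat z) <= Cmod s + Cmod (F 0%nat z - s))%R).
    { eapply Rle_trans; [|apply Cmod_triangle]. right; f_equal; ring. }
    assert (h5 : (K * (1 + r) * r ^ 2 * exp y * sum_f_R0 (fun k => y ^ k / INR (fact k)) N
      <= K * (1 + r) * r ^ 2 * exp y * exp y)%R).
    { apply Rmult_le_compat_l; [|exact h3].
      pose proof (exp_pos y). repeat apply Rmult_le_pos; simpl; try lra; nra. }
    unfold B; simpl in *; lra. }
  eapply Rle_trans; [exact hB|].
  assert (hry : (r <= y ^ 2)%R).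
  { apply Rnot_lt_le; intro hlt. assert (y ^ 4 < r ^ 2)%R by (simpl in *; nra).
    assert (y ^ 4 = y * y ^ 3)%R by ring. simpl in *; nra. }
  assert (h5 : (y ^ 5 <= 120 * exp y)%R).
  { pose proof (exp_ge_term y 5 ltac:(lra)) as h.
    replace (INR (fact 5)) with 120%R in h by (simpl; ring). lra. }
  assert (he1 : (1 <= exp y)%R) by (pose proof (exp_ineq1_le y); lra).
  replace (exp (3 * y)) with (exp y * exp y * exp y)%R
    by (rewrite <- !exp_plus; f_equal; ring).
  set (e := exp y) in *.
  assert (h25 : (y ^ 2 <= y ^ 5)%R) by (apply Rle_pow; [lra | lia]).
  assert (hpy : (1 <= y ^ 2)%R) by (simpl; nra).
  assert (hb1 : (K * (1 + r) <= 2 * K * y ^ 5)%R) by nra.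
  assert (hb2 : (K * (1 + r) * r ^ 2 <= 2 * K * y ^ 5)%R).
  { rewrite <- hy3. replace (2 * K * y ^ 5)%R with (K * (2 * y ^ 2) * y ^ 3)%R by ring.
    apply Rmult_le_compat_r; [apply pow_le; lra|]. apply Rmult_le_compat_l; lra. }
  assert (hee : (1 <= e * e)%R) by nra.
  assert (hp5 : (0 <= 2 * K * y ^ 5)%R).
  { repeat apply Rmult_le_pos; try lra; apply pow_le; lra. }
  apply Rle_trans with (4 * K * y ^ 5 * (e * e))%R.
  - unfold B; fold e. rewrite Rmult_assoc.
    assert (K * (1 + r) * r ^ 2 * (e * e) <= 2 * K * y ^ 5 * (e * e))%R
      by (apply Rmult_le_compat_r; lra).
    nra.
  - assert (4 * K * y ^ 5 <= 480 * K * e)%R by nra.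
    assert (4 * K * y ^ 5 * (e * e) <= 480 * K * e * (e * e))%R
      by (apply Rmult_le_compat_r; lra).
    nra.
Qed.

(** * Maximum modulus and order *)

Lemma continuous_Cmod_comp (f f' : C -> C) (gamma : R -> C) (t : R) :
  is_C_derivative f f' -> ccont gamma -> continuous (fun s => Cmod (f (gamma s))) t.
Proof.
  intros hf hg.
  (* Complex differentiability refers to the neighbourhoods given by the modulus, [ccont] to real
     and imaginary parts; continuity of [gamma] is carried over through
     [Cmod (gamma s - gamma t)]. *)
  assert (hgc : filterlim gamma (locally t)
    (locally (T := AbsRing_UniformSpace C_AbsRing) (gamma t))).
  { apply (filterlim_locally (U := AbsRing_UniformSpace C_AbsRing)). intro eps.
    assert (hd : continuous (fun s => Cmod (gamma s + - gamma t)) t).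
    { apply continuous_Cmod, ccont_plus; [exact hg | apply ccont_const]. }
    apply (filterlim_locally (U := R_UniformSpace)) with (eps := eps) in hd.
    revert hd; apply filter_imp; intros s hs.
    change (Rabs (Cmod (gamma s + - gamma t) - Cmod (gamma t + - gamma t)) < eps)%R in hs.
    replace (gamma t + - gamma t) with (RtoC 0) in hs by ring.
    rewrite Cmod_0, Rminus_0_r, Rabs_pos_eq in hs by apply Cmod_ge_0.
    exact hs. }
  assert (hfc : filterlim f (locally (T := AbsRing_UniformSpace C_AbsRing) (gamma t))
    (locally (T := C_UniformSpace) (f (gamma t)))).
  { apply (ex_derive_continuous (K := C_AbsRing) (V := C_NormedModule)).
    exists (f' (gamma t)); apply hf. }
  apply (filterlim_comp _ _ _ (fun s => f (gamma s)) Cmod _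
    (locally (T := C_UniformSpace) (f (gamma t)))).
  - exact (filterlim_comp _ _ _ gamma f _ _ _ hgc hfc).
  - apply (filterlim_norm (K := C_AbsRing) (V := C_NormedModule)).
Qed.

(** The circle is covered by its upper and lower half, each a graph over [-r, r]; the extreme value
    theorem applies to each half and the larger maximum wins. *)
Lemma max_modulus_ex (f f' : C -> C) (r : R) : is_C_derivative f f' -> (0 <= r)%R ->
  exists m, is_max_modulus f r m.
Proof.
  intros hf hr.
  (* [e] is 1 or -1 and selects the half. As [sqrt] is 0 on negative numbers, [g e] is continuous on
     all of R, as [ccont] demands. *)
  set (g := fun (e x : R) => (x, (e * sqrt (r * r - x * x))%R) : C).
  assert (hg : forall e, ccont (g e)).
  { intro e; apply ccont_pair; intro t; [apply continuous_id|].
    apply (continuous_mult (K := R_AbsRing) (fun _ => e)); [apply continuous_const|].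
    apply (continuous_comp (fun x => r * r - x * x)%R sqrt); [|apply continuous_sqrt].
    apply (ex_derive_continuous (K := R_AbsRing) (V := R_NormedModule)); auto_derive; auto. }
  assert (hmax : forall e, exists x0, (forall x, (- r <= x <= r)%R ->
    (Cmod (f (g e x)) <= Cmod (f (g e x0)))%R) /\ (- r <= x0 <= r)%R).
  { intro e; apply continuity_ab_maj; [lra|]. intros c _.
    apply continuity_pt_filterlim, (continuous_Cmod_comp f f'); auto. }
  assert (hon : forall e x, (e * e = 1)%R -> (- r <= x <= r)%R -> Cmod (g e x) = r).
  { intros e x he hx; unfold Cmod, g; simpl.
    assert (hp : (0 <= r * r - x * x)%R) by nra.
    pose proof (sqrt_sqrt _ hp) as hs.
    replace (_ + _)%R with (r * r)%R; [now apply sqrt_square|].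
    set (s := sqrt (r * r - x * x)) in *.
    replace (e * s * (e * s * 1))%R with (e * e * (s * s))%R by ring.
    rewrite he, hs; ring. }
  destruct (hmax 1%R) as [x1 [hx1 hr1]]; destruct (hmax (-1)%R) as [x2 [hx2 hr2]].
  exists (Rmax (Cmod (f (g 1%R x1))) (Cmod (f (g (-1)%R x2)))); split.
  - apply Rmax_case.
    + exists (g 1%R x1); split; [apply hon; [ring | exact hr1] | reflexivity].
    + exists (g (-1)%R x2); split; [apply hon; [ring | exact hr2] | reflexivity].
  - intros [x y] hz.
    assert (hxy : (r * r - x * x = y * y)%R).
    { rewrite <- hz; unfold Cmod; simpl. rewrite sqrt_sqrt; [ring | nra]. }
    assert (hx : (- r <= x <= r)%R) by (split; nra).
    destruct (Rle_dec 0 y) as [h|h].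
    + replace (x, y) with (g 1%R x : C).
      * eapply Rle_trans; [apply hx1, hx | apply Rmax_l].
      * unfold g; rewrite hxy, sqrt_square by lra; f_equal; ring.
    + replace (x, y) with (g (-1)%R x : C).
      * eapply Rle_trans; [apply hx2, hx | apply Rmax_r].
      * unfold g; rewrite hxy. replace (y * y)%R with ((- y) * (- y))%R by ring.
        rewrite sqrt_square by lra; f_equal; ring.
Qed.

(** The maximum is also the least upper bound of the values, so [Lub_Rbar] defines it as a function
    of the radius without a choice principle. *)
Lemma max_modulus_fun (f f' : C -> C) : is_C_derivative f f' ->
  exists M : R -> R, forall r, (0 <= r)%R -> is_max_modulus f r (M r).
Proof.
  intros hf.
  exists (fun r => real (Lub_Rbar (fun x => exists z, Cmod z = r /\ Cmod (f z) = x))).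
  intros r hr; destruct (max_modulus_ex f f' r hf hr) as [m hm].
  rewrite (is_lub_Rbar_unique _ (Finite m)); [exact hm|].
  destruct hm as [[z0 [hz0 <-]] hm]; split.
  - intros x [z [hz <-]]; now apply hm.
  - intros b hb; apply hb; now exists z0.
Qed.

Lemma ln_nonpos (x : R) : (x <= 0)%R -> ln x = 0%R.
Proof.
  intros h; unfold ln; destruct (Rlt_dec 0 x) as [h'|_]; [|reflexivity].
  exfalso; exact (Rlt_not_le _ _ h' h).
Qed.

(** At the radius r with r^2 = 8 (3b+2)^3 one has ln M >= b and ln r <= (3/2)(ln b + ln 10), so the
    quotient approaches at least 2/3 along these radii. The upper half follows from ln M =
    O(r^(2/3)). *)
Lemma order_two_thirds (f f' : C -> C) (A : R) : is_C_derivative f f' -> (0 < A)%R ->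
  (forall z, (1 <= Cmod z)%R -> (Cmod (f z) <= A * exp (3 * Rpower (Cmod z) (2 / 3)))%R) ->
  (forall b : nat, exists z,
    Cmod z = sqrt (8 * INR (3 * b + 2) ^ 3) /\ (4 ^ b <= Cmod (f z))%R) ->
  is_order f (Finite (2 / 3)).
Proof.
  intros hf hA hup hlow.
  destruct (max_modulus_fun f f' hf) as [M hM]. exists M; split; [exact hM|].
  intros [eps heps]; simpl; split.
  - intro N.
    set (L10 := ln 10).
    (* The exponential makes [L10 < 3/2 * eps * ln x], which absorbs the constant ln 10; [Rabs N]
       pushes the radius beyond [N], since r >= 3b+2. *)
    set (B := (Rabs N + 1 + exp (L10 / (3 / 2 * eps)))%R).
    destruct (nfloor_ex B) as [b [_ hb]].
    { unfold B; pose proof (exp_pos (L10 / (3 / 2 * eps))); pose proof (Rabs_pos N); lra. }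
    pose proof (Rabs_pos N) as hN0. pose proof (Rle_abs N) as hN1.
    pose proof (exp_pos (L10 / (3 / 2 * eps))) as hep.
    set (b' := S b).
    assert (hb' : (B < INR b')%R) by (unfold b'; rewrite S_INR; exact hb).
    set (x := INR b') in *.
    assert (hx1 : (1 < x)%R) by (unfold B in hb'; lra).
    set (n := INR (3 * b' + 2)).
    assert (hn : (n = 3 * x + 2)%R)
      by (unfold n, x; rewrite plus_INR, mult_INR; simpl; ring).
    set (r := sqrt (8 * n ^ 3)).
    assert (hr2 : (r * r = 8 * n ^ 3)%R).
    { apply sqrt_sqrt. apply Rmult_le_pos; [lra | apply pow_le; lra]. }
    assert (hr0 : (0 <= r)%R) by apply sqrt_pos.
    assert (hrn : (n <= r)%R).
    { apply Rnot_lt_le; intro hlt. assert (r * r <= n * n)%R by nra.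
      assert (n * n * 1 < n * n * (8 * n))%R by (apply Rmult_lt_compat_l; nra).
      assert (8 * n ^ 3 = n * n * (8 * n))%R by ring. lra. }
    exists r; split; [unfold B in hb'; lra|].
    assert (hlnr : (0 < ln r)%R) by (rewrite <- ln_1; apply ln_increasing; lra).
    assert (hlnr2 : (ln r <= 3 / 2 * (ln x + L10))%R).
    { assert (h2 : (2 * ln r = ln (8 * n ^ 3))%R)
        by (rewrite <- hr2, ln_mult by lra; ring).
      assert (h3 : (ln (8 * n ^ 3) = 3 * ln (2 * n))%R).
      { replace (8 * n ^ 3)%R with ((2 * n) ^ 3)%R by ring.
        rewrite ln_pow by lra. simpl; ring. }
      (* Here 2n = 6x + 4 <= 10x because x >= 1; this is the origin of the 10. *)
      assert (h4 : (ln (2 * n) <= ln (10 * x))%R) by (apply ln_le; lra).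
      unfold L10; rewrite (ln_mult 10 x) in h4 by lra. lra. }
    destruct (hlow b') as [z [hz hfz]].
    assert (hMr : (4 ^ b' <= M r)%R).
    { eapply Rle_trans; [exact hfz|]. apply (proj2 (hM r hr0)); exact hz. }
    assert (hlnM : (x <= ln (M r))%R).
    { apply Rle_trans with (ln (4 ^ b')).
      - rewrite ln_pow by lra. fold x.
        assert (1 <= ln 4)%R.
        { rewrite <- (ln_exp 1); apply ln_le; [apply exp_pos|].
          pose proof exp_le_3; lra. }
        nra.
      - apply ln_le; [apply pow_lt; lra | exact hMr]. }
    assert (hll : (ln x <= ln (ln (M r)))%R) by (apply ln_le; lra).
    assert (hL10 : (0 < L10)%R) by (unfold L10; rewrite <- ln_1; apply ln_increasing; lra).
    assert (hlx : (L10 < 3 / 2 * eps * ln x)%R).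
    { assert (h : (L10 / (3 / 2 * eps) < ln x)%R).
      { rewrite <- (ln_exp (L10 / (3 / 2 * eps))). apply ln_increasing; [exact hep|].
        unfold B in hb'; lra. }
      apply (Rmult_lt_compat_l (3 / 2 * eps)) in h; [|lra].
      replace (3 / 2 * eps * (L10 / (3 / 2 * eps)))%R with L10 in h by (field; lra).
      exact h. }
    apply (Rmult_lt_reg_r (ln r)); [exact hlnr|].
    unfold Rdiv at 2; rewrite Rmult_assoc, Rinv_l, Rmult_1_r by lra.
    eapply Rlt_le_trans; [|exact hll].
    (* The upper bound on [ln r] may only be multiplied by a nonnegative factor; for large [eps] the
       left side is nonpositive anyway. *)
    destruct (Rle_dec (2 / 3 - eps) 0) as [hn'|hp].
    + apply Rle_lt_trans with 0%R; [nra|]. rewrite <- ln_1; apply ln_increasing; lra.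
    + apply Rle_lt_trans with ((2 / 3 - eps) * (3 / 2 * (ln x + L10)))%R.
      * apply Rmult_le_compat_l; lra.
      * nra.
  (* As y >= 1, ln A + 3y <= K y, hence ln ln M <= ln K + (2/3) ln r. *)
  - set (K := (Rabs (ln A) + 3)%R).
    assert (hK : (3 <= K)%R) by (unfold K; pose proof (Rabs_pos (ln A)); lra).
    exists (2 + exp (ln K / eps))%R; intros r hr.
    pose proof (exp_pos (ln K / eps)) as hep.
    assert (hlnr : (0 < ln r)%R) by (rewrite <- ln_1; apply ln_increasing; lra).
    assert (hlr : (ln K < eps * ln r)%R).
    { assert (h : (ln K / eps < ln r)%R).
      { rewrite <- (ln_exp (ln K / eps)). apply ln_increasing; lra. }
      apply (Rmult_lt_compat_l eps) in h; [|lra].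
      replace (eps * (ln K / eps))%R with (ln K) in h by (field; lra). exact h. }
    apply (Rmult_lt_reg_r (ln r)); [exact hlnr|].
    unfold Rdiv at 1; rewrite Rmult_assoc, Rinv_l, Rmult_1_r by lra.
    destruct (hM r ltac:(lra)) as [[z [hz hfz]] _].
    (* If [ln (M r)] is not positive, the outer [ln] is 0 by convention and the bound is trivial. *)
    destruct (Rle_dec (ln (M r)) 0) as [hneg|hpos].
    { rewrite (ln_nonpos (ln (M r)) hneg); nra. }
    assert (hMpos : (0 < M r)%R).
    { apply Rnot_le_lt; intro h. rewrite (ln_nonpos (M r) h) in hpos; lra. }
    set (y := Rpower r (2 / 3)).
    assert (hy : (1 <= y)%R).
    { unfold y; rewrite <- (Rpower_O r) by lra; apply Rle_Rpower; lra. }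
    assert (hlnM : (ln (M r) <= K * y)%R).
    { assert (h : (M r <= A * exp (3 * y))%R).
      { rewrite <- hfz. unfold y; rewrite <- hz; apply hup; lra. }
      apply ln_le in h; [|exact hMpos].
      rewrite ln_mult, ln_exp in h by (try apply exp_pos; lra).
      unfold K; pose proof (Rle_abs (ln A)); pose proof (Rabs_pos (ln A)); nra. }
    apply ln_le in hlnM; [|lra].
    rewrite ln_mult in hlnM by lra.
    unfold y, Rpower in hlnM; rewrite ln_exp in hlnM. lra.
Qed.

(** * The integrals over rays and arcs *)

(* [w dw = - u^(-3) du] at [u = s]; since [/ 0 = 0] the value at [s = 0] is [0],
   which is the limit, so the ray becomes the compact interval [0, 1]. *)
Definition ray_weight (s : R) : R := ((/ s) ^ 3 * exp (- (s ^ 2 / 2) - (/ s) ^ 2 / 2))%R.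

Lemma ray_weight_0 : ray_weight 0 = 0%R.
Proof. unfold ray_weight; rewrite Rinv_0; ring. Qed.

(** With v = 1/s, the quadratic term of the exponential series gives exp(v^2/2) >= v^4/8, so |v|^3
    exp(-v^2/2) <= 8/|v|. This yields continuity at 0. *)
Lemma ray_weight_bound (s : R) : (Rabs (ray_weight s) <= 8 * Rabs s)%R.
Proof.
  destruct (Req_dec s 0) as [-> | hs].
  - rewrite ray_weight_0, Rabs_R0; lra.
  - unfold ray_weight. set (v := (/ s)%R).
    assert (hv : (0 < Rabs v)%R) by (apply Rabs_pos_lt, Rinv_neq_0_compat, hs).
    assert (hsv : (Rabs s = / Rabs v)%R)
      by (unfold v; rewrite Rabs_inv, Rinv_inv; reflexivity).
    rewrite hsv, Rabs_mult, (Rabs_pos_eq (exp _)) by (apply Rlt_le, exp_pos).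
    rewrite <- RPow_abs.
    assert (he : (exp (- (s ^ 2 / 2) - v ^ 2 / 2) <= exp (- (v ^ 2 / 2)))%R).
    { apply exp_le; pose proof (pow2_ge_0 s); lra. }
    pose proof (exp_ge_term (v ^ 2 / 2) 2) as h.
    assert (hq : (0 <= v ^ 2 / 2)%R) by (pose proof (pow2_ge_0 v); lra).
    specialize (h hq). rewrite <- (pow2_abs v) in *.
    simpl (INR (fact 2)) in h.
    set (a := Rabs v) in *.
    rewrite exp_Ropp in he.
    assert (ha4 : (0 < a ^ 4)%R) by (apply pow_lt, hv).
    assert (h' : (a ^ 4 / 8 <= exp (a ^ 2 / 2))%R)
      by (eapply Rle_trans; [|exact h]; right; field).
    assert (h'' : (/ exp (a ^ 2 / 2) <= / (a ^ 4 / 8))%R)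
      by (apply Rinv_le_contravar; lra).
    apply Rle_trans with (a ^ 3 * / (a ^ 4 / 8))%R; [|right; field; lra].
    apply Rmult_le_compat_l; [apply pow_le; lra | lra].
Qed.

Lemma ex_derive_ray_weight (s : R) : s <> 0%R -> ex_derive ray_weight s.
Proof. intros hs; unfold ray_weight; auto_derive; auto. Qed.

Lemma continuous_ray_weight (s : R) : continuous ray_weight s.
Proof.
  destruct (Req_dec s 0) as [-> | hs].
  - apply (filterlim_locally (U := R_UniformSpace)); intro eps.
    assert (hd : (0 < eps / 8)%R) by (apply Rdiv_lt_0_compat; [apply cond_pos | lra]).
    exists (mkposreal _ hd); intros y hy.
    change (Rabs (y - 0) < eps / 8)%R in hy.
    change (Rabs (ray_weight y - ray_weight 0) < eps)%R.
    rewrite ray_weight_0, Rminus_0_r in *. pose proof (ray_weight_bound y); lra.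
  - now apply (ex_derive_continuous (K := R_AbsRing) (V := R_NormedModule)),
      ex_derive_ray_weight.
Qed.

(** The difference quotient at 0 is h itself, so continuity of h suffices. This avoids
    differentiating [ray_weight] at 0. *)
Lemma is_derive_mult_id_0 (h : R -> R) : continuous h 0%R ->
  is_derive (fun s => s * h s)%R 0%R (h 0%R).
Proof.
  intros hh; apply is_derive_Reals; intros eps heps.
  apply (filterlim_locally (U := R_UniformSpace)) with (eps := mkposreal eps heps) in hh.
  destruct hh as [d hd]; exists d; intros t ht0 ht.
  assert (hb : ball (M := R_UniformSpace) 0%R d t)
    by (change (Rabs (t - 0) < d)%R; now rewrite Rminus_0_r).
  specialize (hd t hb). change (Rabs (h t - h 0) < eps)%R in hd.
  rewrite Rplus_0_l, Rmult_0_l, Rminus_0_r.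
  now replace (t * h t / t)%R with (h t) by (field; exact ht0).
Qed.

(** Off 0 the function is exp(-s^2/2 - 1/(2s^2)), the part of e^phi independent of z, so this is the
    ray version of differentiating e^phi; at 0 both sides vanish. *)
Lemma is_derive_cube_ray_weight (s : R) :
  is_derive (fun s => s ^ 3 * ray_weight s)%R s (ray_weight s * (1 - s ^ 4))%R.
Proof.
  destruct (Req_dec s 0) as [-> | hs].
  - apply (is_derive_ext (fun s => s * (s ^ 2 * ray_weight s))%R); [intro; simpl; ring|].
    replace (ray_weight 0 * (1 - 0 ^ 4))%R with (0 ^ 2 * ray_weight 0)%R
      by (rewrite ray_weight_0; ring).
    apply (is_derive_mult_id_0 (fun s => s ^ 2 * ray_weight s)%R).
    apply (continuous_mult (K := R_AbsRing) (fun s => s ^ 2)%R); [|apply continuous_ray_weight].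
    apply (ex_derive_continuous (K := R_AbsRing) (V := R_NormedModule)); auto_derive; auto.
  - unfold ray_weight; auto_derive; [auto|].
    replace (- (s ^ 2 / 2) - (/ s) ^ 2 / 2)%R with
      (- (s * (s * 1) * / 2) + - (/ s * (/ s * 1) * / 2))%R by (simpl; lra).
    field; exact hs.
Qed.

(** For [e] = 1 or -1 this is the integral over the ray from w = e outward to infinity. Since w dw =
    e^2 r dr, the weight is the same for both rays and [e] enters only through u = es. *)
Definition ray_int (e : R) : nat -> C -> C :=
  expint (fun s => RtoC (ray_weight s)) (fun s => RtoC (e * s)) 0 1.

Definition unit_inv (theta : R) : C := Cexp (- (Ci * RtoC theta)).

(** On the circle w dw = i w^2 dtheta; the rest is the factor of the kernel independent of z, with
    [unit_inv] in the role of u = 1/w. *)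
Definition arc_weight (theta : R) : C :=
  Ci * arc theta ^ 2 * Cexp (- ((unit_inv theta ^ 2 + arc theta ^ 2) / 2)).

Definition arc_int (a b : R) : nat -> C -> C := expint arc_weight unit_inv a b.

Lemma ccont_ray_weight : ccont (fun s => RtoC (ray_weight s)).
Proof. apply ccont_RtoC, continuous_ray_weight. Qed.

Lemma ccont_line (e : R) : ccont (fun s => RtoC (e * s)).
Proof.
  apply ccont_RtoC; intro t.
  apply (ex_derive_continuous (K := R_AbsRing) (V := R_NormedModule)); auto_derive; auto.
Qed.

Lemma ccont_RtoC_id : ccont (fun s : R => RtoC s).
Proof. apply ccont_RtoC; intro; apply continuous_id. Qed.

Lemma ccont_arc : ccont arc.
Proof. apply ccont_Cexp, ccont_mult; [apply ccont_const | apply ccont_RtoC_id]. Qed.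

Lemma ccont_unit_inv : ccont unit_inv.
Proof. apply ccont_Cexp, ccont_opp, ccont_mult; [apply ccont_const | apply ccont_RtoC_id]. Qed.

Lemma ccont_arc_weight : ccont arc_weight.
Proof.
  apply (ccont_mult (fun t => Ci * arc t ^ 2)).
  - apply ccont_mult; [apply ccont_const | apply ccont_pow, ccont_arc].
  - apply ccont_Cexp, ccont_opp, ccont_mult; [|apply ccont_const].
    apply ccont_plus; apply ccont_pow; [apply ccont_unit_inv | apply ccont_arc].
Qed.

Lemma arc_cos_sin (t : R) : arc t = (cos t, sin t).
Proof.
  unfold arc, Cexp; apply C_eq; simpl;
    replace (0 * t - 1 * 0)%R with 0%R by ring; replace (0 * 0 + 1 * t)%R with t by ring;
    rewrite exp_0; ring.
Qed.

Lemma unit_inv_cos_sin (t : R) : unit_inv t = (cos t, (- sin t)%R).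
Proof.
  unfold unit_inv, Cexp; apply C_eq; simpl;
    replace (- (0 * t - 1 * 0))%R with 0%R by ring;
    replace (- (0 * 0 + 1 * t))%R with (- t)%R by ring;
    rewrite exp_0, ?cos_neg, ?sin_neg; ring.
Qed.

Lemma arc_unit_inv (t : R) : arc t * unit_inv t = 1.
Proof.
  unfold arc, unit_inv; rewrite <- Cexp_plus, <- Cexp_0; f_equal; ring.
Qed.

Lemma arc_neq_0 (t : R) : arc t <> 0.
Proof.
  intro h; pose proof (arc_unit_inv t) as h1; rewrite h, Cmult_0_l in h1.
  apply C1_nz; auto.
Qed.

Lemma Cinv_arc (t : R) : / arc t = unit_inv t.
Proof.
  replace (unit_inv t) with (/ arc t * (arc t * unit_inv t))
    by (field; apply arc_neq_0).
  rewrite arc_unit_inv; ring.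
Qed.

Lemma Cmod_unit_inv (t : R) : Cmod (unit_inv t) = 1%R.
Proof.
  unfold unit_inv; rewrite Cmod_Cexp; rewrite <- exp_0; f_equal; simpl; ring.
Qed.

Lemma cderiv_arc (t : R) : cderiv arc t (Ci * arc t).
Proof.
  unfold arc; apply (cderiv_Cexp (fun s => Ci * RtoC s)).
  apply (cderiv_eq _ _ (Ci * 1)); [ring | apply cderiv_scal, cderiv_id].
Qed.

Lemma cderiv_unit_inv (t : R) : cderiv unit_inv t (- Ci * unit_inv t).
Proof.
  unfold unit_inv; apply (cderiv_Cexp (fun s => - (Ci * RtoC s))).
  apply (cderiv_ext (fun s => - Ci * RtoC s)); [intro; ring|].
  apply (cderiv_eq _ _ (- Ci * 1)); [ring | apply cderiv_scal, cderiv_id].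
Qed.

Lemma tame_ray_int (e : R) : Rabs e = 1%R -> tame (ray_int e).
Proof.
  intro he; unfold ray_int; apply tame_expint; [exact Rle_0_1 | exact ccont_ray_weight | exact (ccont_line e) |].
  intros t ht; rewrite Cmod_R, Rabs_mult, he, Rabs_pos_eq; lra.
Qed.

Lemma tame_arc_int (a b : R) : (a <= b)%R -> tame (arc_int a b).
Proof.
  intro hab; apply tame_expint; [exact hab | apply ccont_arc_weight | apply ccont_unit_inv |].
  intros t _; rewrite Cmod_unit_inv; lra.
Qed.

(** * Moment recurrences with boundary terms *)

Lemma ccont_ode_factor (u : R -> C) (n : nat) (z : C) : ccont u ->
  ccont (fun t => u t ^ 4 - z * u t ^ 3 - RtoC (INR n) * u t ^ 2 - 1).
Proof.
  intro hu.
  assert (hp : forall c m, ccont (fun t => - (c * u t ^ m)))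
    by (intros; apply ccont_opp, ccont_mult; [apply ccont_const | now apply ccont_pow]).
  unfold Cminus.
  exact (ccont_plus _ _ (ccont_plus _ _ (ccont_plus _ _ (ccont_pow _ 4 hu) (hp z 3%nat))
    (hp (RtoC (INR n)) 2%nat)) (ccont_const (- (1)))).
Qed.

(** Collecting the four integrals into one leaves an integrand that is to be recognised as an exact
    derivative, separately on arcs and on rays. *)
Lemma expint_recurrence (g u : R -> C) (a b : R) (n : nat) (z : C) : ccont g -> ccont u ->
  expint g u a b (4 + n) z - z * expint g u a b (3 + n) z
    - RtoC (INR n) * expint g u a b (2 + n) z - expint g u a b n z
  = cint (fun t => g t * u t ^ n * Cexp (z * u t)
      * (u t ^ 4 - z * u t ^ 3 - RtoC (INR n) * u t ^ 2 - 1)) a b.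
Proof.
  intros hg hu.
  assert (hc : forall m, ccont (fun t => g t * u t ^ m * Cexp (z * u t)))
    by (intro; now apply ccont_expint).
  assert (hs : forall c m, ccont (fun t => c * (g t * u t ^ m * Cexp (z * u t))))
    by (intros; apply ccont_mult; [apply ccont_const | apply hc]).
  rewrite (cint_ext _ (fun t => g t * u t ^ (4 + n) * Cexp (z * u t)
    + (- z * (g t * u t ^ (3 + n) * Cexp (z * u t))
    + (- RtoC (INR n) * (g t * u t ^ (2 + n) * Cexp (z * u t))
    + - (1) * (g t * u t ^ n * Cexp (z * u t))))))
    by (intros t _; simpl; ring).
  assert (h1 := ccont_plus _ _ (hs (- RtoC (INR n)) (2 + n)%nat) (hs (- (1)) n)).
  assert (h2 := ccont_plus _ _ (hs (- z) (3 + n)%nat) h1).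
  rewrite (cint_plus _ _ _ _ (hc (4 + n)%nat) h2).
  rewrite (cint_plus _ _ _ _ (hs (- z) (3 + n)%nat) h1).
  rewrite (cint_plus _ _ _ _ (hs (- RtoC (INR n)) (2 + n)%nat) (hs (- (1)) n)).
  rewrite !(cint_scal _ _ _ _ (hc _)). unfold expint; ring.
Qed.

Lemma cderiv_sqr (f : R -> C) (t : R) (l : C) :
  cderiv f t l -> cderiv (fun s => f s ^ 2) t (RtoC 2 * (l * f t)).
Proof.
  intros h; eapply cderiv_eq; [|apply (cderiv_pow f t l 2 h)].
  replace (INR 2) with 2%R by (simpl; ring). simpl; ring.
Qed.

Lemma RtoC_2_neq_0 : RtoC 2 <> 0.
Proof. intro h; apply RtoC_inj in h; lra. Qed.

(** Differentiating [x ^ n] produces the exponent [pred n], and x x^(n-1) = x^n fails for n = 0 with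
    truncated predecessor; the factor [INR n] repairs that case. *)
Lemma INR_pow_pred (x : C) (n : nat) :
  RtoC (INR n) * (x * x ^ Init.Nat.pred n) = RtoC (INR n) * x ^ n.
Proof. destruct n; [simpl; ring | reflexivity]. Qed.

(** The integrand is the derivative of u^n e^phi along the circle, where u' = -iu and w' = iw, so
    only the end values remain. *)
Lemma arc_recurrence (a b : R) (n : nat) (z : C) :
  arc_int a b (4 + n) z - z * arc_int a b (3 + n) z
    - RtoC (INR n) * arc_int a b (2 + n) z - arc_int a b n z
  = unit_inv b ^ n * Cexp (z * unit_inv b - (unit_inv b ^ 2 + arc b ^ 2) / 2)
    - unit_inv a ^ n * Cexp (z * unit_inv a - (unit_inv a ^ 2 + arc a ^ 2) / 2).
Proof.
  unfold arc_int; rewrite expint_recurrence by (apply ccont_arc_weight || apply ccont_unit_inv).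
  set (X := fun t => z * unit_inv t - (unit_inv t ^ 2 + arc t ^ 2) / 2).
  assert (hX : forall t, cderiv X t (Ci * (unit_inv t ^ 2 - z * unit_inv t - arc t ^ 2))).
  { intro t; unfold X.
    apply (cderiv_ext (fun t => z * unit_inv t + (- / RtoC 2) * (unit_inv t ^ 2 + arc t ^ 2)));
      [intro; unfold Cdiv; ring|].
    eapply cderiv_eq; [|apply cderiv_plus; [apply cderiv_scal, cderiv_unit_inv|]].
    2:{ apply cderiv_scal, cderiv_plus; apply cderiv_sqr;
          [apply cderiv_unit_inv | apply cderiv_arc]. }
    simpl; field; exact RtoC_2_neq_0. }
  apply (cint_FTC (fun t => unit_inv t ^ n * Cexp (X t))).
  - intro t.
    eapply cderiv_eq;
      [|apply cderiv_mult; [apply cderiv_pow, cderiv_unit_inv | apply cderiv_Cexp, hX]].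
    unfold arc_weight.
    replace (X t) with (- ((unit_inv t ^ 2 + arc t ^ 2) / 2) + z * unit_inv t)
      by (unfold X; ring).
    rewrite Cexp_plus. set (E := Cexp (- _)); set (W := Cexp (z * _)).
    transitivity (Ci * E * W * (- (RtoC (INR n) * unit_inv t ^ n)
      + unit_inv t ^ n * (unit_inv t ^ 2 - z * unit_inv t - arc t ^ 2))).
    + rewrite <- INR_pow_pred. ring.
    (* The two sides agree only modulo w u = 1; this form exposes the product (w u)^2. *)
    + transitivity (Ci * E * W * unit_inv t ^ n * ((arc t * unit_inv t) ^ 2 * (unit_inv t ^ 2
        - z * unit_inv t - RtoC (INR n)) - arc t ^ 2)); [|ring].
      rewrite arc_unit_inv; ring.
  - apply ccont_mult; [apply ccont_expint; [apply ccont_arc_weight | apply ccont_unit_inv]|].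
    apply ccont_ode_factor; exact ccont_unit_inv.
Qed.

(** A primitive is -u^n e^(zu) s^3 [ray_weight s]. It vanishes at s = 0, so only the end s = 1
    contributes, where s^3 [ray_weight s] is e^(-1). *)
Lemma ray_recurrence (e : R) (n : nat) (z : C) : (e * e = 1)%R ->
  ray_int e (4 + n) z - z * ray_int e (3 + n) z
    - RtoC (INR n) * ray_int e (2 + n) z - ray_int e n z
  = - (RtoC e ^ n * Cexp (z * RtoC e - 1)).
Proof.
  intro he.
  unfold ray_int; rewrite expint_recurrence by (apply ccont_ray_weight || apply ccont_line).
  set (u := fun s => RtoC (e * s)).
  set (om := fun s => RtoC (s ^ 3 * ray_weight s)).
  assert (hu : forall t, cderiv u t (RtoC e)).
  { intro t; apply (cderiv_RtoC (fun s => e * s)%R); auto_derive; [auto | apply Rmult_1_r]. }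
  assert (hom : forall t, cderiv om t (RtoC (ray_weight t * (1 - t ^ 4))))
    by (intro t; apply cderiv_RtoC, is_derive_cube_ray_weight).
  assert (hee : RtoC e * RtoC e = 1) by (rewrite <- RtoC_mult, he; reflexivity).
  rewrite (cint_FTC (fun s => - (1) * (u s ^ n * (Cexp (z * u s) * om s)))).
  - unfold om, u. rewrite ray_weight_0.
    replace (ray_weight 1) with (exp (-1))
      by (unfold ray_weight; rewrite Rinv_1; replace (- (1 ^ 2 / 2) - 1 ^ 2 / 2)%R with (-1)%R
          by (simpl; lra); ring).
    rewrite Rmult_1_r, pow1, Rmult_1_l, (Rmult_0_r (0 ^ 3)).
    replace (z * RtoC e - 1) with (z * RtoC e + RtoC (-1)) by (rewrite RtoC_m1; ring).
    rewrite Cexp_plus, Cexp_RtoC; ring.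
  - intro t.
    assert (ht : RtoC t = RtoC e * u t).
    { unfold u; rewrite RtoC_mult.
      replace (RtoC e * (RtoC e * RtoC t)) with (RtoC e * RtoC e * RtoC t) by ring.
      rewrite hee; ring. }
    eapply cderiv_eq; [|apply cderiv_scal, cderiv_mult; [apply cderiv_pow, hu|];
      apply cderiv_mult; [apply cderiv_Cexp, cderiv_scal, hu | apply hom]].
    unfold om. change (RtoC (e * t)) with (u t).
    rewrite !RtoC_mult, RtoC_minus, !RtoC_pow, ht.
    set (x := u t); set (W := Cexp _); set (G := RtoC (ray_weight t)).
    transitivity (- (((RtoC e * RtoC e) ^ 2 * x ^ 2 * (RtoC (INR n) * (x * x ^ Init.Nat.pred n))
      + x ^ n * (z * (RtoC e * RtoC e) ^ 2 * x ^ 3 + 1 - (RtoC e * RtoC e) ^ 2 * x ^ 4))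
      * (W * G))); [ring|].
    rewrite INR_pow_pred, hee; ring.
  - assert (huc : ccont u) by apply ccont_line.
    apply ccont_mult; [apply ccont_expint; [apply ccont_ray_weight | exact huc]|].
    apply ccont_ode_factor; exact huc.
Qed.

(** * The moments of H and U *)

Definition H_moment (n : nat) (z : C) : C :=
  - (1) * ray_int 1 n z + ray_int (-1) n z + arc_int 0 PI n z.

Definition U_moment (n : nat) (z : C) : C :=
  1 / (2 * PI * Ci) * arc_int 0 (2 * PI) n z.

Lemma tame_H_moment : tame H_moment.
Proof.
  apply (tame_plus (fun n z => - (1) * ray_int 1 n z + ray_int (-1) n z)).
  - apply (tame_plus (fun n z => - (1) * ray_int 1 n z)).
    + apply tame_scal, tame_ray_int, Rabs_R1.
    + apply tame_ray_int; rewrite Rabs_left; lra.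
  - apply tame_arc_int; pose proof PI_RGT_0; lra.
Qed.

Lemma tame_U_moment : tame U_moment.
Proof. apply tame_scal, tame_arc_int; pose proof PI_RGT_0; lra. Qed.

Lemma arc_0 : arc 0 = 1.
Proof. rewrite arc_cos_sin, cos_0, sin_0; reflexivity. Qed.

Lemma unit_inv_0 : unit_inv 0 = 1.
Proof. rewrite unit_inv_cos_sin, cos_0, sin_0, Ropp_0; reflexivity. Qed.

Lemma arc_PI : arc PI = RtoC (-1).
Proof. rewrite arc_cos_sin, cos_PI, sin_PI; reflexivity. Qed.

Lemma unit_inv_PI : unit_inv PI = RtoC (-1).
Proof. rewrite unit_inv_cos_sin, cos_PI, sin_PI, Ropp_0; reflexivity. Qed.

(** The end values of the half circle at w = 1 and w = -1 cancel those of the two rays attached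
    there. *)
Lemma H_moment_recurrence : moment_recurrence H_moment.
Proof.
  intros n z; unfold H_moment.
  pose proof (ray_recurrence 1 n z ltac:(ring)) as h1.
  pose proof (ray_recurrence (-1) n z ltac:(ring)) as h2.
  pose proof (arc_recurrence 0 PI n z) as h3.
  rewrite arc_0, arc_PI, unit_inv_0, unit_inv_PI in h3.
  replace (z * RtoC (-1) - (RtoC (-1) ^ 2 + RtoC (-1) ^ 2) / 2) with (z * RtoC (-1) - 1) in h3
    by (rewrite RtoC_m1; field; exact RtoC_2_neq_0).
  replace (z * 1 - (1 ^ 2 + 1 ^ 2) / 2) with (z * 1 - 1) in h3
    by (field; exact RtoC_2_neq_0).
  match type of h1 with ?a = _ => match type of h2 with ?b = _ => match type of h3 with ?c = _ =>
    transitivity (- (1) * a + b + c); [ring|] end end end.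
  rewrite h1, h2, h3; ring.
Qed.

Lemma U_moment_recurrence : moment_recurrence U_moment.
Proof.
  intros n z; unfold U_moment.
  pose proof (arc_recurrence 0 (2 * PI) n z) as h.
  rewrite !arc_cos_sin, !unit_inv_cos_sin, cos_2PI, sin_2PI, cos_0, sin_0 in h.
  match type of h with ?a = _ => transitivity (1 / (2 * PI * Ci) * a); [ring|] end.
  rewrite h; ring.
Qed.

(** * From the contour integrals to integrals over compact intervals *)

Lemma ccont_continuous (f : R -> C) (t : R) : ccont f ->
  continuous (U := C_R_NormedModule) f t.
Proof.
  intros hf; destruct (hf t) as [h1 h2].
  apply (filterlim_locally (U := C_UniformSpace)); intro eps.
  pose proof (proj1 (filterlim_locally (U := R_UniformSpace) _ _) h1 eps) as h1'.
  pose proof (proj1 (filterlim_locally (U := R_UniformSpace) _ _) h2 eps) as h2'.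
  generalize (filter_and _ _ h1' h2'); apply filter_imp.
  intros s [hs1 hs2]; split; assumption.
Qed.

(** The hypothesis makes K dr the pullback of -f ds under s = 1/r, so the integral of K over [1, b]
    is that of f over [1/b, 1]. As b grows, its lower limit tends to 0, on which the integral
    depends continuously. *)
Lemma is_RInt_gen_inv (K f : R -> C) : ccont f ->
  (forall r, (0 < r)%R -> K r = RtoC ((/ r) ^ 2) * f (/ r)%R) ->
  is_RInt_gen (V := C_R_NormedModule) K (at_point 1%R) (Rbar_locally p_infty) (cint f 0 1).
Proof.
  intros hf hK.
  assert (hint : forall b, (1 <= b)%R ->
    is_RInt (V := C_R_NormedModule) K 1 b (cint f (/ b) 1)).
  { intros b hb.
    assert (h1 : is_RInt (V := C_R_NormedModule) (fun y => scal (- (/ y) ^ 2)%R (f (/ y)%R)) 1 b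
      (cint f 1 (/ b))).
    { rewrite <- (is_RInt_unique (V := C_R_CompleteNormedModule) _ _ _ _
        (is_RInt_cint f 1 (/ b) hf)).
      rewrite <- Rinv_1 at 2.
      apply (is_RInt_comp (V := C_R_CompleteNormedModule) f Rinv (fun y => - (/ y) ^ 2)%R).
      - intros x _; now apply ccont_continuous.
      - intros x hx; rewrite Rmin_left, Rmax_right in hx by exact hb; split.
        + auto_derive; [lra|]. field; lra.
        + apply (ex_derive_continuous (K := R_AbsRing) (V := R_NormedModule)).
          auto_derive; lra. }
    (* The map r -> 1/r reverses orientation; the sign restores the order of the limits. *)
    apply (is_RInt_opp (V := C_R_NormedModule)) in h1.
    replace (cint f (/ b) 1) with (opp (cint f 1 (/ b)) : C_R_NormedModule).
    - apply (is_RInt_ext (V := C_R_NormedModule) _ _ _ _ _) with (2 := h1).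
      intros x hx; rewrite Rmin_left, Rmax_right in hx by exact hb.
      rewrite hK by lra. apply C_eq.
      + change (- (- (/ x) ^ 2 * fst (f (/ x))) = (/ x) ^ 2 * fst (f (/ x)) - 0 * snd (f (/ x)))%R.
        ring.
      + change (- (- (/ x) ^ 2 * snd (f (/ x))) = (/ x) ^ 2 * snd (f (/ x)) + 0 * fst (f (/ x)))%R.
        ring.
    - pose proof (cint_Chasles f 1 (/ b) 1 hf) as h.
      assert (h0 : cint f 1 1 = 0).
      { apply is_RInt_cint_eq, (is_RInt_point (V := C_R_NormedModule)). }
      rewrite h0 in h. change (- cint f 1 (/ b) = cint f (/ b) 1).
      transitivity (cint f 1 (/ b) + cint f (/ b) 1 - cint f 1 (/ b)); [rewrite h|]; ring. }
  assert (hlim : filterlim (fun b => cint f (/ b) 1) (Rbar_locally p_infty)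
    (locally (T := C_R_NormedModule) (cint f 0 1))).
  { apply (filterlim_comp _ _ _ Rinv (fun x => cint f x 1) _ (locally 0%R)).
    - apply (filterlim_Rbar_inv p_infty); discriminate.
    - apply (ex_derive_continuous (K := R_AbsRing) (V := C_R_NormedModule) (fun x => cint f x 1) 0%R).
      exists (opp (f 0%R) : C_R_NormedModule).
      apply (is_derive_RInt' (V := C_R_NormedModule) f (fun x => cint f x 1) 0 1).
      + apply filter_forall; intro a; now apply is_RInt_cint.
      + now apply ccont_continuous. }
  intros P hP; specialize (hlim P hP).
  destruct hlim as [M hM].
  apply (Filter_prod _ _ _ (fun a => a = 1%R) (fun b => (Rmax 1 M < b)%R)).
  - reflexivity.
  - now exists (Rmax 1 M).
  - intros a b -> hb. pose proof (Rmax_l 1 M); pose proof (Rmax_r 1 M).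
    exists (cint f (/ b) 1); split; [apply hint; simpl; lra | apply hM; lra].
Qed.

Lemma path_velocity_cderiv (gamma : R -> C) (t : R) (l : C) :
  cderiv gamma t l -> path_velocity gamma t = l.
Proof.
  intros [h1 h2]; apply C_eq; apply is_derive_unique; assumption.
Qed.

Lemma path_velocity_line (e t : R) : path_velocity (fun r => RtoC (e * r)) t = RtoC e.
Proof.
  apply path_velocity_cderiv, (cderiv_RtoC (fun s => e * s)%R).
  auto_derive; [auto | apply Rmult_1_r].
Qed.

Lemma kernel_ray (e r : R) (z : C) : (e * e = 1)%R -> (0 < r)%R ->
  kernel z (RtoC (e * r)) * path_velocity (fun r => RtoC (e * r)) r
  = RtoC ((/ r) ^ 2)
    * (RtoC (ray_weight (/ r)) * RtoC (e * / r) ^ 0 * Cexp (z * RtoC (e * / r))).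
Proof.
  intros he hr. rewrite path_velocity_line. unfold kernel, ray_weight.
  assert (he0 : RtoC e <> 0) by (intro h; apply RtoC_inj in h; rewrite h in he; lra).
  assert (hr0 : RtoC r <> 0) by (intro h; apply RtoC_inj in h; lra).
  assert (hee : RtoC e * RtoC e = 1) by (rewrite <- RtoC_mult, he; reflexivity).
  replace (z / RtoC (e * r) - 1 / (2 * RtoC (e * r) ^ 2) - RtoC (e * r) ^ 2 / 2) with
    (z * RtoC (e * / r) + RtoC (- ((/ r) ^ 2 / 2) - (/ / r) ^ 2 / 2)).
  - rewrite Cexp_plus, Cexp_RtoC, Rinv_inv. simpl Cpow.
    replace ((/ r) ^ 2 )%R with (/ r * / r)%R by ring.
    rewrite !RtoC_mult, RtoC_pow, RtoC_inv by lra.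
    set (W := Cexp _); set (E := RtoC (exp _)).
    transitivity (RtoC e * RtoC e * RtoC r * (W * E)); [ring|].
    rewrite hee; field; exact hr0.
  - rewrite Rinv_inv. unfold Rdiv.
    rewrite !RtoC_minus, !RtoC_opp, !RtoC_mult, !RtoC_pow, !RtoC_inv by lra.
    (* The inserted factors e e = 1 are removed from the quadratic terms to reach one side and from
       the z term to reach the other. *)
    transitivity (z * ((RtoC e * RtoC e) / (RtoC e * RtoC r)) - 1 / (2 * ((RtoC e * RtoC e) * RtoC r ^ 2))
      - (RtoC e * RtoC e) * RtoC r ^ 2 / 2).
    + rewrite hee at 2 3. field; repeat split; try assumption; exact RtoC_2_neq_0.
    + rewrite hee at 1. field; repeat split; try assumption; exact RtoC_2_neq_0.
Qed.

Lemma is_RInt_gen_ray (e : R) (z : C) : (e * e = 1)%R ->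
  is_RInt_gen (V := C_R_NormedModule)
    (fun r => kernel z (RtoC (e * r)) * path_velocity (fun r => RtoC (e * r)) r)
    (at_point 1%R) (Rbar_locally p_infty) (ray_int e 0 z).
Proof.
  intro he; unfold ray_int, expint. apply is_RInt_gen_inv.
  - apply (ccont_expint _ _ 0 z ccont_ray_weight (ccont_line e)).
  - intros r hr; now apply kernel_ray.
Qed.

Lemma contour_arc (a b : R) (z : C) :
  contour_int (kernel z) arc (at_point a) (at_point b) = arc_int a b 0 z.
Proof.
  unfold contour_int.
  apply (is_RInt_gen_unique (V := C_R_CompleteNormedModule)).
  apply (is_RInt_gen_at_point (V := C_R_NormedModule)).
  apply (is_RInt_ext (V := C_R_NormedModule)
    (fun t => arc_weight t * unit_inv t ^ 0 * Cexp (z * unit_inv t))).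
  - intros t _. rewrite (path_velocity_cderiv _ _ _ (cderiv_arc t)).
    unfold arc_weight, kernel. rewrite <- Cinv_arc.
    replace (z / arc t - 1 / (2 * arc t ^ 2) - arc t ^ 2 / 2) with
      (- (((/ arc t) ^ 2 + arc t ^ 2) / 2) + z * / arc t).
    + rewrite Cexp_plus; simpl; ring.
    + field; exact (arc_neq_0 t).
  - apply is_RInt_cint, ccont_expint; [apply ccont_arc_weight | apply ccont_unit_inv].
Qed.

Lemma U_eq : U = U_moment 0.
Proof.
  apply functional_extensionality; intro z.
  unfold U, U_moment, unit_circle_int; now rewrite contour_arc.
Qed.

Lemma H_eq : H = H_moment 0.
Proof.
  apply functional_extensionality; intro z.
  unfold H, H_moment, contour_A_int; rewrite contour_arc.
  assert (h1 : contour_int (kernel z) (fun r : R => RtoC r) (Rbar_locally p_infty) (at_point 1%R)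
    = - (1) * ray_int 1 0 z).
  { replace (fun r : R => RtoC r) with (fun r : R => RtoC (1 * r))
      by (apply functional_extensionality; intro; now rewrite Rmult_1_l).
    unfold contour_int; apply (is_RInt_gen_unique (V := C_R_CompleteNormedModule)).
    replace (- (1) * ray_int 1 0 z) with (opp (ray_int 1 0 z : C_R_NormedModule))
      by (change (- ray_int 1 0 z = - (1) * ray_int 1 0 z); ring).
    (* A_1 runs inward, against the orientation of [ray_int]. *)
    apply (is_RInt_gen_swap (V := C_R_NormedModule)), is_RInt_gen_ray; ring. }
  assert (h2 : contour_int (kernel z) (fun r : R => - RtoC r) (at_point 1%R) (Rbar_locally p_infty)
    = ray_int (-1) 0 z).
  { replace (fun r : R => - RtoC r) with (fun r : R => RtoC (-1 * r))
      by (apply functional_extensionality; intro; rewrite RtoC_mult, RtoC_m1; ring).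
    unfold contour_int; apply (is_RInt_gen_unique (V := C_R_CompleteNormedModule)).
    apply is_RInt_gen_ray; ring. }
  rewrite h1, h2; ring.
Qed.

(** * The identity between U and H *)

Lemma two_PI_Ci_neq_0 : 2 * PI * Ci <> 0.
Proof.
  intro h; apply (f_equal Cmod) in h.
  rewrite !Cmod_mult, !Cmod_R, Cmod_Ci, !Rabs_pos_eq in h; pose proof PI_RGT_0; lra.
Qed.

Lemma unit_inv_shift (t : R) : unit_inv (t + PI) = - unit_inv t.
Proof. rewrite !unit_inv_cos_sin, neg_cos, neg_sin. apply C_eq; simpl; ring. Qed.

Lemma arc_shift (t : R) : arc (t + PI) = - arc t.
Proof. rewrite !arc_cos_sin, neg_cos, neg_sin. apply C_eq; simpl; ring. Qed.

(** Replacing z by -z amounts to replacing w by -w, and w dw is invariant. The two rays are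
    exchanged, so they cancel in the sum, and the upper half circle turns into the lower one, which
    completes the circle. *)
Lemma U_moment_H_moment (z : C) :
  2 * PI * Ci * U_moment 0 z = H_moment 0 z + H_moment 0 (- z).
Proof.
  unfold U_moment, H_moment.
  assert (hc : forall c X : C, c <> 0 -> c * (1 / c * X) = X) by (intros; field; assumption).
  rewrite hc by exact two_PI_Ci_neq_0.
  assert (hr : forall e, ray_int e 0 (- z) = ray_int (- e) 0 z).
  { intro e; apply cint_ext; intros t _; simpl Cpow; do 2 f_equal.
    rewrite Ropp_mult_distr_l_reverse, RtoC_opp; ring. }
  rewrite !hr. replace (- -1)%R with 1%R by ring. replace (- (1))%R with (-1)%R by ring.
  assert (ha : arc_int 0 PI 0 (- z) = arc_int PI (2 * PI) 0 z).
  { unfold arc_int, expint.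
    replace PI with (0 + PI)%R at 2 by ring. replace (2 * PI)%R with (PI + PI)%R by ring.
    rewrite <- (cint_shift (fun t => arc_weight t * unit_inv t ^ 0 * Cexp (z * unit_inv t)))
      by (apply ccont_expint; [apply ccont_arc_weight | apply ccont_unit_inv]).
    apply cint_ext; intros t _. unfold arc_weight; rewrite unit_inv_shift, arc_shift.
    replace (z * - unit_inv t) with (- z * unit_inv t) by ring.
    replace ((- unit_inv t) ^ 2 + (- arc t) ^ 2) with (unit_inv t ^ 2 + arc t ^ 2) by ring.
    ring. }
  rewrite ha.
  assert (hs : arc_int 0 (2 * PI) 0 z = arc_int 0 PI 0 z + arc_int PI (2 * PI) 0 z).
  { unfold arc_int, expint; symmetry; apply cint_Chasles, ccont_expint;
      [apply ccont_arc_weight | apply ccont_unit_inv]. }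
  rewrite hs; simpl; ring.
Qed.

(** * Lower bound on the imaginary axis *)

(* The shift by [PI / 2] absorbs the factor [i] of [z = i x]. *)
Definition fourier (j : Z) (t : R) : C := Cexp (Ci * RtoC (IZR j * (t - PI / 2))).

Lemma fourier_mult (j k : Z) (t : R) : fourier j t * fourier k t = fourier (j + k) t.
Proof.
  unfold fourier; rewrite <- Cexp_plus, plus_IZR, !RtoC_mult, RtoC_plus; f_equal; ring.
Qed.

Lemma ccont_fourier (j : Z) : ccont (fourier j).
Proof.
  apply ccont_Cexp, ccont_mult; [apply ccont_const|]. apply ccont_RtoC; intro t.
  apply (ex_derive_continuous (K := R_AbsRing) (V := R_NormedModule)); auto_derive; auto.
Qed.

Lemma Cexp_2PI_Z (j : Z) : Cexp (Ci * RtoC (IZR j * (2 * PI))) = 1.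
Proof.
  assert (hn : forall n : nat, Cexp (Ci * RtoC (INR n * (2 * PI))) = 1).
  { intro n; change (arc (INR n * (2 * PI)) = 1). rewrite arc_cos_sin.
    replace (INR n * (2 * PI))%R with (0 + 2 * INR n * PI)%R by ring.
    now rewrite cos_period, sin_period, cos_0, sin_0. }
  destruct (Z_le_gt_dec 0 j) as [hj|hj].
  - rewrite <- (Z2Nat.id j hj), <- INR_IZR_INZ; apply hn.
  - replace (Cexp _) with (Cexp (Ci * RtoC (IZR j * (2 * PI)))
      * Cexp (Ci * RtoC (INR (Z.to_nat (- j)) * (2 * PI)))) by (rewrite hn; ring).
    rewrite <- Cexp_plus, <- Cexp_0; f_equal.
    rewrite INR_IZR_INZ, Z2Nat.id, opp_IZR by lia. rewrite !RtoC_mult, RtoC_opp; ring.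
Qed.

Lemma cint_fourier (j : Z) :
  cint (fourier j) 0 (2 * PI) = RtoC (if Z.eqb j 0 then 2 * PI else 0)%R.
Proof.
  assert (hd : forall t, cderiv (fourier j) t (Ci * RtoC (IZR j) * fourier j t)).
  { intro t; unfold fourier.
    apply (cderiv_Cexp (fun t => Ci * RtoC (IZR j * (t - PI / 2)))), cderiv_scal.
    apply (cderiv_RtoC (fun t => IZR j * (t - PI / 2))%R). auto_derive; [auto | ring]. }
  destruct (Z.eqb_spec j 0) as [-> | hj].
  - rewrite (cint_ext _ (fun _ => 1)).
    + rewrite (cint_FTC (fun t => RtoC t)).
      * rewrite <- RtoC_minus; f_equal; ring.
      * apply cderiv_id.
      * apply ccont_const.
    + intros t _; unfold fourier. rewrite Rmult_0_l, Cmult_0_r; apply Cexp_0.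
  - assert (hj0 : RtoC (IZR j) <> 0).
    { intro h; apply RtoC_inj in h. apply hj, eq_IZR, h. }
    assert (h : cint (fun t => Ci * RtoC (IZR j) * fourier j t) 0 (2 * PI) = 0).
    { rewrite (cint_FTC (fourier j)).
      - replace (fourier j (2 * PI)) with
          (Cexp (Ci * RtoC (IZR j * (2 * PI))) * fourier j 0).
        + rewrite Cexp_2PI_Z; ring.
        + unfold fourier; rewrite <- Cexp_plus; f_equal.
          rewrite <- Cmult_plus_distr_l, <- RtoC_plus; do 2 f_equal; ring.
      - exact hd.
      - apply ccont_mult; [apply ccont_const | apply ccont_fourier]. }
    rewrite cint_scal in h by apply ccont_fourier.
    replace (cint (fourier j) 0 (2 * PI)) with
      (/ (Ci * RtoC (IZR j)) * (Ci * RtoC (IZR j) * cint (fourier j) 0 (2 * PI))).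
    + rewrite h; ring.
    + field; split; [exact hj0 | apply Ci_nz].
Qed.

(* The coefficient of [w^(-j)] in [(x / w + w^2 / 2 + w^(-2) / 2)^m]. *)
Fixpoint laurent_coef (x : R) (m : nat) (j : Z) : R :=
  match m with
  | O => if Z.eqb j 0 then 1 else 0
  | S m => x * laurent_coef x m (j - 1)
           + (laurent_coef x m (j + 2) + laurent_coef x m (j - 2)) / 2
  end%R.

Definition laurent_poly (x : R) (t : R) : C :=
  RtoC x * fourier (-1) t + RtoC (/ 2) * (fourier 2 t + fourier (-2) t).

Lemma ccont_laurent_poly (x : R) : ccont (laurent_poly x).
Proof.
  apply ccont_plus; (apply ccont_mult; [apply ccont_const|]).
  - apply ccont_fourier.
  - apply ccont_plus; apply ccont_fourier.
Qed.

(** Pairing with [fourier j] extracts a coefficient by orthogonality; splitting off one factor of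
    the power shifts [j] by -1, 2 and -2, as in the recursion of [laurent_coef]. *)
Lemma cint_laurent_poly (x : R) (m : nat) : forall j,
  cint (fun t => fourier j t * laurent_poly x t ^ m) 0 (2 * PI)
  = RtoC (2 * PI * laurent_coef x m j).
Proof.
  induction m as [|m IH]; intro j.
  - rewrite (cint_ext _ (fourier j)) by (intros; simpl; ring).
    rewrite cint_fourier; simpl. destruct (Z.eqb j 0); f_equal; ring.
  - assert (hc : forall k, ccont (fun t => fourier k t * laurent_poly x t ^ m)).
    { intro k; apply ccont_mult; [apply ccont_fourier | apply ccont_pow, ccont_laurent_poly]. }
    assert (hs : forall c k, ccont (fun t => c * (fourier k t * laurent_poly x t ^ m))).
    { intros c k; apply ccont_mult; [apply ccont_const | apply hc]. }
    rewrite (cint_ext _ (fun t => RtoC x * (fourier (j - 1) t * laurent_poly x t ^ m)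
      + (RtoC (/ 2) * (fourier (j + 2) t * laurent_poly x t ^ m)
      + RtoC (/ 2) * (fourier (j - 2) t * laurent_poly x t ^ m)))).
    + rewrite (cint_plus _ _ _ _ (hs (RtoC x) (j - 1)%Z)
        (ccont_plus _ _ (hs (RtoC (/ 2)) (j + 2)%Z) (hs (RtoC (/ 2)) (j - 2)%Z))).
      rewrite (cint_plus _ _ _ _ (hs (RtoC (/ 2)) (j + 2)%Z) (hs (RtoC (/ 2)) (j - 2)%Z)).
      rewrite !(cint_scal _ _ _ _ (hc _)), !IH.
      rewrite <- !RtoC_mult, <- !RtoC_plus; f_equal. simpl; field.
    + intros t _. unfold Z.sub; simpl Z.opp. rewrite <- !fourier_mult.
      simpl Cpow; unfold laurent_poly at 1; ring.
Qed.

Lemma laurent_coef_pos (x : R) (m : nat) : (0 <= x)%R -> forall j, (0 <= laurent_coef x m j)%R.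
Proof.
  intros hx; induction m as [|m IH]; intro j; simpl.
  - destruct (Z.eqb j 0); lra.
  - pose proof (IH (j - 1)%Z); pose proof (IH (j + 2)%Z); pose proof (IH (j - 2)%Z).
    assert (0 <= x * laurent_coef x m (j - 1))%R by now apply Rmult_le_pos.
    lra.
Qed.

(** The coefficient is a weighted count of walks from 0 with steps +1 (weight x) and +2, -2 (weight
    1/2 each). The bound is the weight of one walk: b rounds of +1, +1, -2 back to 0, then +1, +1 to
    reach 2. *)
Lemma laurent_coef_lower (x : R) (b : nat) : (0 <= x)%R ->
  (x ^ 2 * (x ^ 2 / 2) ^ b <= laurent_coef x (3 * b + 2) 2)%R.
Proof.
  intros hx.
  assert (h1 : forall m j, (x * laurent_coef x m j <= laurent_coef x (S m) (j + 1))%R).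
  { intros m j; simpl; replace (j + 1 - 1)%Z with j by lia.
    pose proof (laurent_coef_pos x m hx (j + 1 + 2)); pose proof (laurent_coef_pos x m hx (j + 1 - 2)).
    lra. }
  assert (h2 : forall m j, (laurent_coef x m j / 2 <= laurent_coef x (S m) (j - 2))%R).
  { intros m j; simpl; replace (j - 2 + 2)%Z with j by lia.
    pose proof (laurent_coef_pos x m hx (j - 2 - 2)); pose proof (laurent_coef_pos x m hx (j - 2 - 1)).
    assert (0 <= x * laurent_coef x m (j - 2 - 1))%R by now apply Rmult_le_pos.
    lra. }
  assert (hb : ((x ^ 2 / 2) ^ b <= laurent_coef x (3 * b) 0)%R).
  { induction b as [|b IH]; [simpl; lra|].
    replace (3 * S b)%nat with (S (S (S (3 * b)))) by lia.
    pose proof (h1 (3 * b)%nat 0%Z) as e1; simpl (0 + 1)%Z in e1.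
    pose proof (h1 (S (3 * b)) 1%Z) as e2; simpl (1 + 1)%Z in e2.
    pose proof (h2 (S (S (3 * b))) 2%Z) as e3; simpl (2 - 2)%Z in e3.
    apply (Rmult_le_compat_l x) in e1; [|exact hx].
    apply (Rmult_le_compat_l (x * x)) in IH; [|nra].
    change ((x ^ 2 / 2) ^ S b)%R with (x ^ 2 / 2 * (x ^ 2 / 2) ^ b)%R.
    replace (x ^ 2 / 2 * (x ^ 2 / 2) ^ b)%R with (x * x * (x ^ 2 / 2) ^ b / 2)%R by field.
    lra. }
  replace (3 * b + 2)%nat with (S (S (3 * b))) by lia.
  pose proof (h1 (3 * b)%nat 0%Z) as e1; simpl (0 + 1)%Z in e1.
  pose proof (h1 (S (3 * b)) 1%Z) as e2; simpl (1 + 1)%Z in e2.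
  apply (Rmult_le_compat_l x) in e1; [|exact hx].
  apply (Rmult_le_compat_l (x * x)) in hb; [|nra].
  replace (x ^ 2 * (x ^ 2 / 2) ^ b)%R with (x * x * (x ^ 2 / 2) ^ b)%R by ring.
  lra.
Qed.

Lemma Cmod_fourier (j : Z) (t : R) : Cmod (fourier j t) = 1%R.
Proof.
  unfold fourier; rewrite Cmod_Cexp, <- exp_0; f_equal; simpl; ring.
Qed.

Lemma Cmod_laurent_poly (x t : R) : (0 <= x)%R -> (Cmod (laurent_poly x t) <= x + 1)%R.
Proof.
  intros hx; unfold laurent_poly.
  eapply Rle_trans; [apply Cmod_triangle|].
  rewrite !Cmod_mult, !Cmod_R, Cmod_fourier, !Rabs_pos_eq by lra.
  pose proof (Cmod_triangle (fourier 2 t) (fourier (-2) t)) as h.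
  rewrite !Cmod_fourier in h; lra.
Qed.

(** Put w = iv with v = [fourier 1 t]. Then z/w = x/v, the quadratic part becomes (v^2 + v^(-2))/2,
    and i w^2 = -i v^2, which together with 1/(2 pi i) gives the sign. *)
Lemma U_moment_imaginary (x : R) :
  2 * PI * U_moment 0 (Ci * RtoC x)
  = - cint (fun t => fourier 2 t * Cexp (laurent_poly x t)) 0 (2 * PI).
Proof.
  assert (hc : ccont (fun t => fourier 2 t * Cexp (laurent_poly x t))).
  { apply ccont_mult; [apply ccont_fourier | apply ccont_Cexp, ccont_laurent_poly]. }
  assert (hCi : Ci * Ci = - (1)) by (apply C_eq; simpl; ring).
  assert (hf : forall t, arc t = Ci * fourier 1 t /\ unit_inv t = - Ci * fourier (-1) t).
  { intro t; rewrite arc_cos_sin, unit_inv_cos_sin.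
    assert (hq : forall j, fourier j t = arc (IZR j * (t - PI / 2))) by reflexivity.
    rewrite !hq, !arc_cos_sin.
    replace (IZR (-1) * (t - PI / 2))%R with (PI / 2 - t)%R by ring.
    replace (IZR 1 * (t - PI / 2))%R with (- (PI / 2 - t))%R by ring.
    rewrite cos_neg, sin_neg, cos_shift, sin_shift.
    split; apply C_eq; simpl; ring. }
  unfold U_moment, arc_int, expint.
  rewrite (cint_ext _ (fun t => - Ci * (fourier 2 t * Cexp (laurent_poly x t)))).
  - rewrite cint_scal by exact hc.
    assert (hpi : RtoC PI <> 0) by (intro h; apply RtoC_inj in h; pose proof PI_RGT_0; lra).
    field; repeat split; (exact Ci_nz || exact hpi || exact RtoC_2_neq_0).
  - intros t _; unfold arc_weight; destruct (hf t) as [-> ->].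
    change (fourier 2 t) with (fourier (1 + 1) t). rewrite <- fourier_mult.
    replace (laurent_poly x t) with
      (- (((- Ci * fourier (-1) t) ^ 2 + (Ci * fourier 1 t) ^ 2) / 2)
       + Ci * RtoC x * (- Ci * fourier (-1) t)).
    + rewrite Cexp_plus. simpl Cpow.
      set (E := Cexp (- _)); set (W := Cexp (Ci * _ * _)).
      transitivity (Ci * (Ci * Ci) * (fourier 1 t * fourier 1 t) * (E * W)); [ring|].
      rewrite hCi; ring.
    + unfold laurent_poly. change (fourier 2 t) with (fourier (1 + 1) t);
      change (fourier (-2) t) with (fourier (-1 + -1) t).
      rewrite <- !fourier_mult, (RtoC_inv 2) by lra. simpl Cpow.
      transitivity (- (((Ci * Ci) * (fourier (-1) t * fourier (-1) t)
        + (Ci * Ci) * (fourier 1 t * fourier 1 t)) / 2) - (Ci * Ci) * RtoC x * fourier (-1) t).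
      * field; exact RtoC_2_neq_0.
      * rewrite hCi; field; exact RtoC_2_neq_0.
Qed.

Lemma csum_RtoC_ge (r : nat -> R) (M N : nat) : (forall k, (0 <= r k)%R) -> (M < N)%nat ->
  (r M <= Re (csum (fun k => RtoC (r k)) N))%R.
Proof.
  intros hr.
  assert (h0 : forall n, (0 <= Re (csum (fun k => RtoC (r k)) n))%R).
  { induction n as [|n IH]; simpl in *; [lra | specialize (hr n); unfold Re in *; lra]. }
  induction N as [|N IH]; intro hM; [lia|].
  simpl csum. change (r M <= Re (csum (fun k => RtoC (r k)) N) + r N)%R.
  destruct (Nat.eq_dec M N) as [-> | hne].
  - specialize (h0 N); lra.
  - assert (M < N)%nat as hlt by lia. specialize (IH hlt); specialize (hr N); lra.
Qed.

(** For every truncation order beyond [m] the integrated exponential series is a sum of nonnegative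
    reals containing the [m]-th term, and the truncation error tends to 0. *)
Lemma U_moment_lower (x : R) (m : nat) : (0 <= x)%R ->
  (laurent_coef x m 2 / INR (fact m) <= Cmod (U_moment 0 (Ci * RtoC x)))%R.
Proof.
  intros hx. pose proof PI_RGT_0 as hpi.
  set (f := fun t => fourier 2 t * Cexp (laurent_poly x t)).
  set (r := fun k => (/ INR (fact k) * (2 * PI * laurent_coef x k 2))%R).
  assert (hU : (2 * PI * Cmod (U_moment 0 (Ci * RtoC x)) = Cmod (cint f 0 (2 * PI)))%R).
  { unfold f; rewrite <- (Cmod_opp (cint _ _ _)), <- U_moment_imaginary.
    rewrite !Cmod_mult, !Cmod_R, !Rabs_pos_eq by lra; reflexivity. }
  assert (hc : forall k, ccont (fun t => RtoC (/ INR (fact k)) * (fourier 2 t * laurent_poly x t ^ k))).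
  { intro k; apply ccont_mult; [apply ccont_const|].
    apply ccont_mult; [apply ccont_fourier | apply ccont_pow, ccont_laurent_poly]. }
  assert (hcf : ccont f)
    by (apply ccont_mult; [apply ccont_fourier | apply ccont_Cexp, ccont_laurent_poly]).
  assert (hr : (r m <= Cmod (cint f 0 (2 * PI)))%R).
  { apply (le_of_le_plus_pow_fact _ _ (2 * PI * exp (x + 1)) (x + 1)).
    intro N0; exists (N0 + m + 1)%nat; split; [lia|].
    set (N := (N0 + m + 1)%nat).
    set (g := fun t => csum (fun k => RtoC (/ INR (fact k)) * (fourier 2 t * laurent_poly x t ^ k)) N).
    assert (hg : ccont g) by (apply (ccont_csum (fun k t => RtoC (/ INR (fact k))
      * (fourier 2 t * laurent_poly x t ^ k))); exact hc).
    assert (hgI : cint g 0 (2 * PI) = csum (fun k => RtoC (r k)) N).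
    { unfold g. rewrite (cint_csum (fun k t => RtoC (/ INR (fact k))
        * (fourier 2 t * laurent_poly x t ^ k))) by exact hc.
      apply csum_ext; intro k; rewrite cint_scal, cint_laurent_poly, <- RtoC_mult.
      - reflexivity.
      - apply ccont_mult; [apply ccont_fourier | apply ccont_pow, ccont_laurent_poly]. }
    assert (hd : (Cmod (cint f 0 (2 * PI) - cint g 0 (2 * PI))
      <= 2 * PI * exp (x + 1) * ((x + 1) ^ N / INR (fact N)))%R).
    { replace (cint f 0 (2 * PI) - cint g 0 (2 * PI)) with
        (cint (fun t => f t + - (1) * g t) 0 (2 * PI)).
      2:{ rewrite (cint_plus f _ _ _ hcf (ccont_mult _ _ (ccont_const (- (1))) hg)).
          rewrite (cint_scal _ g _ _ hg); ring. }
      set (B := ((x + 1) ^ N * exp (x + 1) / INR (fact N))%R).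
      eapply Rle_trans.
      - apply (cint_bound _ (fun _ => B)); [lra | | | apply ex_RInt_const].
        + apply ccont_plus; [exact hcf | apply ccont_mult; [apply ccont_const | exact hg]].
        + intros t _.
          replace (f t + - (1) * g t) with
            (fourier 2 t * (Cexp (laurent_poly x t) - exp_trunc (laurent_poly x t) N)).
          * rewrite Cmod_mult, Cmod_fourier, Rmult_1_l.
            eapply Rle_trans; [apply Cexp_trunc_bound|].
            pose proof (Cmod_laurent_poly x t hx). pose proof (Cmod_ge_0 (laurent_poly x t)).
            unfold B, Rdiv; apply Rmult_le_compat_r.
            { apply Rlt_le, Rinv_0_lt_compat, INR_fact_lt_0. }
            apply Rmult_le_compat; [now apply pow_le | apply Rlt_le, exp_pos | |].
            { now apply pow_incr. }
            { now apply exp_le. }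
          * unfold f, g, exp_trunc.
            transitivity (fourier 2 t * Cexp (laurent_poly x t) - fourier 2 t * csum (fun k =>
              RtoC (/ INR (fact k)) * laurent_poly x t ^ k) N); [ring|].
            rewrite csum_mult.
            rewrite (csum_ext (fun k => fourier 2 t * _)
              (fun k => RtoC (/ INR (fact k)) * (fourier 2 t * laurent_poly x t ^ k)))
              by (intro; ring).
            ring.
      - rewrite RInt_const. unfold scal; simpl; unfold mult; simpl. unfold B.
        right; unfold Rdiv; ring. }
    assert (hm : (r m <= Cmod (cint g 0 (2 * PI)))%R).
    { rewrite hgI. eapply Rle_trans; [apply (csum_RtoC_ge r m N)|].
      - intro k; unfold r. pose proof (laurent_coef_pos x k hx 2).
        pose proof (Rinv_0_lt_compat _ (INR_fact_lt_0 k)).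
        apply Rmult_le_pos; [lra | apply Rmult_le_pos; lra].
      - unfold N; lia.
      - eapply Rle_trans; [apply Rle_abs | apply re_le_Cmod]. }
    eapply Rle_trans; [exact hm|].
    replace (cint g 0 (2 * PI)) with
      (cint f 0 (2 * PI) + - (cint f 0 (2 * PI) - cint g 0 (2 * PI))) by ring.
    eapply Rle_trans; [apply Cmod_triangle|]. rewrite Cmod_opp; lra. }
  rewrite <- hU in hr.
  apply (Rmult_le_reg_l (2 * PI)); [lra|].
  eapply Rle_trans; [|exact hr]. unfold r; right; unfold Rdiv; ring.
Qed.

Lemma fact_le_pow (n m : nat) : (n <= m)%nat -> (INR (fact n) <= INR m ^ n)%R.
Proof.
  induction n as [|n IH]; intro h; [simpl; lra|].
  rewrite fact_simpl, mult_INR; simpl pow.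
  apply Rmult_le_compat; [apply pos_INR | apply pos_INR | apply le_INR, h | apply IH; lia].
Qed.

(** The chosen term has degree N = 3b+2 and is divided by N! <= n^N, where n = N as a real. The
    radius makes x^2/2 = 4n^3, so each round of three steps pays for its n^3 and gains a factor 4;
    the remaining x^2 covers n^2. *)
Lemma U_moment_growth (b : nat) :
  (4 ^ b <= Cmod (U_moment 0 (Ci * RtoC (sqrt (8 * INR (3 * b + 2) ^ 3)))))%R.
Proof.
  set (N := (3 * b + 2)%nat). set (n := INR N). set (x := sqrt (8 * n ^ 3)).
  assert (hn : (2 <= n)%R).
  { unfold n, N; rewrite plus_INR; simpl (INR 2). pose proof (pos_INR (3 * b)); lra. }
  assert (hx2 : (x ^ 2 = 8 * n ^ 3)%R).
  { unfold x; rewrite pow2_sqrt; [reflexivity|].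
    apply Rmult_le_pos; [lra | apply pow_le; lra]. }
  eapply Rle_trans; [|apply (U_moment_lower x N), sqrt_pos].
  apply Rle_trans with (x ^ 2 * (x ^ 2 / 2) ^ b / INR (fact N))%R.
  - pose proof (INR_fact_lt_0 N) as hf. pose proof (fact_le_pow N N (le_n N)) as hfn. fold n in hfn.
    apply (Rmult_le_reg_r (INR (fact N))); [exact hf|].
    unfold Rdiv at 1; rewrite (Rmult_assoc _ (/ INR (fact N))), Rinv_l, Rmult_1_r by lra.
    rewrite hx2. replace (8 * n ^ 3 / 2)%R with (4 * n ^ 3)%R by field.
    apply Rle_trans with (4 ^ b * n ^ N)%R.
    + apply Rmult_le_compat_l; [apply pow_le; lra | exact hfn].
    + unfold N; rewrite pow_add, pow_mult, Rpow_mult_distr.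
      assert (h23 : (n ^ 2 <= 8 * n ^ 3)%R).
      { replace (8 * n ^ 3)%R with (n ^ 2 * (8 * n))%R by ring.
        rewrite <- (Rmult_1_r (n ^ 2)) at 1.
        apply Rmult_le_compat_l; [apply pow_le; lra | lra]. }
      replace (4 ^ b * ((n ^ 3) ^ b * n ^ 2))%R with (n ^ 2 * (4 ^ b * (n ^ 3) ^ b))%R by ring.
      apply Rmult_le_compat_r; [|exact h23].
      apply Rmult_le_pos; apply pow_le; [lra | apply pow_le; lra].
  - unfold Rdiv at 1 3; apply Rmult_le_compat_r.
    { apply Rlt_le, Rinv_0_lt_compat, INR_fact_lt_0. }
    apply laurent_coef_lower, sqrt_pos.
Qed.

Lemma Re_cint (f : R -> C) (a b : R) : Re (cint f a b) = RInt (fun t => Re (f t)) a b.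
Proof. reflexivity. Qed.

(** * Linear independence *)

(** This is the real part of H'(0). The rays contribute -2 times the integral of s [ray_weight s],
    and on the half circle the real part of the integrand is -sin t times an exponential, so nothing
    can cancel. *)
Lemma H_moment_1_0_neg : (Re (H_moment 1 (RtoC 0)) < 0)%R.
Proof.
  pose proof PI_RGT_0 as hpi.
  assert (hray : forall e, Re (ray_int e 1 (RtoC 0)) = (e * RInt (fun s => s * ray_weight s) 0 1)%R).
  { intro e. unfold ray_int, expint; rewrite Re_cint.
    rewrite (RInt_ext _ (fun s => scal e (s * ray_weight s)%R)).
    - apply (RInt_scal (V := R_CompleteNormedModule)).
      apply (ex_RInt_continuous (V := R_CompleteNormedModule)); intros s _.
      apply (continuous_mult (K := R_AbsRing) (fun s => s)); [apply continuous_id|].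
      apply continuous_ray_weight.
    - intros s _. rewrite Cmult_0_l, Cexp_0.
      change ((RtoC (ray_weight s) * RtoC (e * s) ^ 1 * 1)) with
        (RtoC (ray_weight s) * (RtoC (e * s) * 1) * 1).
      rewrite !Cmult_1_r, <- RtoC_mult.
      change (ray_weight s * (e * s) = e * (s * ray_weight s))%R; ring. }
  assert (hpos : (0 <= RInt (fun s => s * ray_weight s) 0 1)%R).
  { apply RInt_ge_0; [lra | |].
    - apply (ex_RInt_continuous (V := R_CompleteNormedModule)); intros s _.
      apply (continuous_mult (K := R_AbsRing) (fun s => s)); [apply continuous_id|].
      apply continuous_ray_weight.
    - intros s hs; apply Rmult_le_pos; [lra|]. unfold ray_weight.
      apply Rmult_le_pos; [|apply Rlt_le, exp_pos].
      apply pow_le, Rlt_le, Rinv_0_lt_compat; lra. }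
  set (h := fun t => (sin t * exp (sin t ^ 2 - cos t ^ 2))%R).
  assert (hh : forall t, continuous h t).
  { intro t; apply (ex_derive_continuous (K := R_AbsRing) (V := R_NormedModule)).
    unfold h; auto_derive; auto. }
  assert (harc : Re (arc_int 0 PI 1 (RtoC 0)) = (- RInt h 0 PI)%R).
  { unfold arc_int, expint; rewrite Re_cint.
    rewrite (RInt_ext _ (fun s => opp (h s))).
    - apply (RInt_opp (V := R_CompleteNormedModule)).
      apply (ex_RInt_continuous (V := R_CompleteNormedModule)); intros s _; apply hh.
    - intros s _. rewrite Cmult_0_l, Cexp_0. unfold arc_weight.
      replace (- ((unit_inv s ^ 2 + arc s ^ 2) / 2)) with (RtoC (sin s ^ 2 - cos s ^ 2)).
      + rewrite Cexp_RtoC.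
        replace (Ci * arc s ^ 2 * RtoC (exp (sin s ^ 2 - cos s ^ 2)) * unit_inv s ^ 1 * 1) with
          (Ci * arc s * (arc s * unit_inv s) * RtoC (exp (sin s ^ 2 - cos s ^ 2)))
          by (simpl; ring).
        rewrite arc_unit_inv, arc_cos_sin.
        unfold h, opp; simpl; ring.
      + rewrite unit_inv_cos_sin, arc_cos_sin.
        replace ((cos s, (- sin s)%R) ^ 2 + (cos s, sin s) ^ 2) with
          (RtoC 2 * RtoC (cos s ^ 2 - sin s ^ 2))
          by (apply C_eq; simpl; ring).
        rewrite !RtoC_minus; field; exact RtoC_2_neq_0. }
  assert (hhpos : (0 < RInt h 0 PI)%R).
  { apply RInt_gt_0; [lra | |].
    - intros t ht; unfold h; apply Rmult_lt_0_compat; [apply sin_gt_0; lra | apply exp_pos].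
    - intros t _; apply hh. }
  unfold H_moment.
  change (Re (- (1) * ray_int 1 1 (RtoC 0) + ray_int (-1) 1 (RtoC 0) + arc_int 0 PI 1 (RtoC 0)))
    with ((- (1) * Re (ray_int 1 1 (RtoC 0)) - - 0 * Im (ray_int 1 1 (RtoC 0)))
      + Re (ray_int (-1) 1 (RtoC 0)) + Re (arc_int 0 PI 1 (RtoC 0)))%R.
  rewrite !hray, harc; lra.
Qed.

(** * The reflection z -> -z and the differential equation *)

Lemma is_C_derivative_reflect (f f' : C -> C) :
  is_C_derivative f f' -> is_C_derivative (fun z => f (- z)) (fun z => - f' (- z)).
Proof.
  intros hf z.
  replace (- f' (- z)) with (scal (opp one : C_AbsRing) (f' (- z) : C_NormedModule))
    by (change (- (1) * f' (- z) = - f' (- z)); ring).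
  apply (is_derive_comp (K := C_AbsRing) (V := C_NormedModule) f (fun z : C => - z)).
  - apply hf.
  - apply (is_derive_opp (K := C_AbsRing) (V := AbsRing_NormedModule C_AbsRing) (fun z => z)).
    apply is_derive_id.
Qed.

Lemma is_C_derivative_opp (f f' : C -> C) :
  is_C_derivative f f' -> is_C_derivative (fun z => - f z) (fun z => - f' z).
Proof.
  intros hf z; apply (is_derive_opp (K := C_AbsRing) (V := C_NormedModule)), hf.
Qed.

(** The third derivative changes sign together with its coefficient z, and the fourth derivative
    does not change sign, so the equation is invariant. *)
Lemma solves_ode_reflect (f : C -> C) : solves_ode f -> solves_ode (fun z => f (- z)).
Proof.
  intros [f1 [f2 [f3 [f4 [h1 [h2 [h3 [h4 h]]]]]]]].
  exists (fun z => - f1 (- z)), (fun z => - - f2 (- z)), (fun z => - - - f3 (- z)),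
    (fun z => - - - - f4 (- z)).
  split; [exact (is_C_derivative_reflect _ _ h1)|].
  split; [exact (is_C_derivative_opp _ _ (is_C_derivative_reflect _ _ h2))|].
  split; [exact (is_C_derivative_opp _ _ (is_C_derivative_opp _ _
    (is_C_derivative_reflect _ _ h3)))|].
  split; [exact (is_C_derivative_opp _ _ (is_C_derivative_opp _ _ (is_C_derivative_opp _ _
    (is_C_derivative_reflect _ _ h4))))|].
  intro z; rewrite <- (h (- z)); ring.
Qed.

Lemma solves_ode_moment (F : nat -> C -> C) :
  tame F -> moment_recurrence F -> solves_ode (F 0%nat).
Proof.
  intros hF hrec. exists (F 1%nat), (F 2%nat), (F 3%nat), (F 4%nat).
  repeat (split; [now apply tame_deriv|]).
  intro z; rewrite <- (hrec 0%nat z). simpl; ring.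
Qed.

(** An even H would have H'(0) = -H'(0), against [H_moment_1_0_neg]. The factor [c] gives the form
    in which a linear relation, compared at z and -z, arrives. *)
Lemma H_not_even (c : C) : (forall z, c * H z = c * H (- z)) -> c = 0.
Proof.
  intro h. destruct (Ceq_dec c 0) as [e|hc]; [exact e | exfalso].
  assert (heven : forall z, H z = H (- z)).
  { intro z. replace (H z) with (/ c * (c * H z)) by (field; exact hc).
    rewrite h; field; exact hc. }
  assert (hd : is_C_derivative H (H_moment 1))
    by (rewrite H_eq; exact (tame_deriv _ 0 tame_H_moment)).
  pose proof (is_C_derivative_reflect _ _ hd (RtoC 0)) as h1.
  apply (is_derive_ext (K := C_AbsRing) (V := C_NormedModule) _ H) in h1;
    [|intro; symmetry; apply heven].
  apply is_C_derive_unique in h1. rewrite (is_C_derive_unique _ _ _ (hd (RtoC 0))) in h1.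
  replace (- RtoC 0) with (RtoC 0) in h1 by ring.
  pose proof H_moment_1_0_neg as hneg.
  apply (f_equal Re) in h1. change (Re (H_moment 1 (RtoC 0)) = - Re (H_moment 1 (RtoC 0)))%R in h1.
  lra.
Qed.

Lemma U_H (z : C) : 2 * PI * Ci * U z = H z + H (- z).
Proof. rewrite U_eq, H_eq; apply U_moment_H_moment. Qed.

Lemma U_even (z : C) : U (- z) = U z.
Proof.
  assert (h : forall X, X = / (2 * PI * Ci) * (2 * PI * Ci * X)).
  { intro X; rewrite Cmult_assoc, Cinv_l by exact two_PI_Ci_neq_0; ring. }
  rewrite (h (U (- z))), (h (U z)), !U_H. replace (- - z) with z by ring. ring.
Qed.

Lemma U_not_zero (c : C) : (forall z, c * U z = 0) -> c = 0.
Proof.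
  intro h. destruct (Ceq_dec c 0) as [e|hc]; [exact e | exfalso].
  (* Already for b = 0 the growth estimate gives a point with |U| >= 1. *)
  pose proof (U_moment_growth 0) as hg. rewrite <- U_eq in hg.
  set (z := Ci * _) in hg.
  assert (hz : U z = 0) by (replace (U z) with (/ c * (c * U z)) by (field; exact hc);
    rewrite h; ring).
  rewrite hz, Cmod_0 in hg; simpl in hg; lra.
Qed.

(** Subtracting the relation at -z from the relation at z removes the even function U and leaves [b]
    times the odd part of H. *)
Lemma lin_indep_U_H : lin_indep U H.
Proof.
  intros a b h.
  assert (hb : b = 0).
  { apply H_not_even; intro z. pose proof (h z) as h1; pose proof (h (- z)) as h2.
    rewrite U_even in h2.
    transitivity (a * U z + b * H z - a * U z); [ring|]. rewrite h1, <- h2; ring. }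
  split; [|exact hb]. subst b.
  apply U_not_zero; intro z; rewrite <- (h z); ring.
Qed.

Lemma lin_indep_U_Hneg : lin_indep U (fun z => H (- z)).
Proof.
  intros a b h; apply lin_indep_U_H; intro z.
  rewrite <- (h (- z)), U_even. replace (- - z) with z by ring; reflexivity.
Qed.

(** Comparing z and -z forces a = b because H is not even; then the relation is a multiple of U. *)
Lemma lin_indep_H_Hneg : lin_indep H (fun z => H (- z)).
Proof.
  intros a b h.
  assert (hab : a - b = 0).
  { apply H_not_even; intro z. pose proof (h z) as h1; pose proof (h (- z)) as h2; simpl in h2.
    replace (- - z) with z in h2 by ring.
    transitivity (a * H z + b * H (- z) - b * (H z + H (- z))); [ring|]. rewrite h1, <- h2; ring. }
  assert (e : a = b) by (transitivity (a - b + b); [ring | rewrite hab; ring]).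
  subst b.
  assert (ha : a * (2 * PI * Ci) = 0).
  { apply U_not_zero; intro z. rewrite <- Cmult_assoc, U_H, <- (h z); ring. }
  assert (a = 0); [|split; assumption].
  replace a with (a * (2 * PI * Ci) * / (2 * PI * Ci)).
  - rewrite ha; ring.
  - rewrite <- Cmult_assoc, Cinv_r by exact two_PI_Ci_neq_0; ring.
Qed.

Lemma Cmod_Ci_RtoC (x : R) : (0 <= x)%R -> Cmod (Ci * RtoC x) = x.
Proof. intro hx; rewrite Cmod_mult, Cmod_Ci, Cmod_R, Rabs_pos_eq by exact hx; ring. Qed.

(** At the point where |U| >= 4^b, |H(z)| + |H(-z)| >= 2 pi |U| >= 2 * 4^b, so z or -z works; both
    have the same modulus. *)
Lemma H_growth (b : nat) : exists z,
  Cmod z = sqrt (8 * INR (3 * b + 2) ^ 3) /\ (4 ^ b <= Cmod (H z))%R.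
Proof.
  set (x := sqrt (8 * INR (3 * b + 2) ^ 3)). set (z := Ci * RtoC x).
  assert (hz : Cmod z = x) by apply Cmod_Ci_RtoC, sqrt_pos.
  pose proof (U_moment_growth b) as hU. rewrite <- U_eq in hU. fold x z in hU.
  pose proof (f_equal Cmod (U_H z)) as h.
  rewrite !Cmod_mult, !Cmod_R, Cmod_Ci, !Rabs_pos_eq in h by (pose proof PI_RGT_0; lra).
  pose proof (Cmod_triangle (H z) (H (- z))) as ht.
  pose proof PI2_1 as hpi. assert (h4 : (0 < 4 ^ b)%R) by (apply pow_lt; lra).
  destruct (Rle_dec (4 ^ b) (Cmod (H z))) as [h1|h1].
  - now exists z.
  - exists (- z); rewrite Cmod_opp; split; [exact hz|]. nra.
Qed.

Theorem theorem11 :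
  let Hneg : C -> C := fun z => H (- z) in
  (solves_ode U /\ solves_ode H /\ solves_ode Hneg) /\
  (lin_indep U H /\ lin_indep U Hneg /\ lin_indep H Hneg) /\
  (is_order U (Finite (2 / 3)) /\ is_order H (Finite (2 / 3)) /\
   is_order Hneg (Finite (2 / 3))) /\
  (forall z : C, 2 * PI * Ci * U z = H z + H (- z)).
Proof.
  assert (hU : solves_ode U)
    by (rewrite U_eq; exact (solves_ode_moment _ tame_U_moment U_moment_recurrence)).
  assert (hH : solves_ode H)
    by (rewrite H_eq; exact (solves_ode_moment _ tame_H_moment H_moment_recurrence)).
  destruct (growth_bound _ tame_U_moment U_moment_recurrence) as [A [hA hAU]].
  destruct (growth_bound _ tame_H_moment H_moment_recurrence) as [B [hB hBH]].
  rewrite <- U_eq in hAU; rewrite <- H_eq in hBH.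
  assert (dU : is_C_derivative U (U_moment 1))
    by (rewrite U_eq; exact (tame_deriv _ 0 tame_U_moment)).
  assert (dH : is_C_derivative H (H_moment 1))
    by (rewrite H_eq; exact (tame_deriv _ 0 tame_H_moment)).
  intro Hneg; split; [|split; [|split]].
  - split; [exact hU | split; [exact hH | exact (solves_ode_reflect _ hH)]].
  - split; [exact lin_indep_U_H | split; [exact lin_indep_U_Hneg | exact lin_indep_H_Hneg]].
  - split; [|split].
    + apply (order_two_thirds _ _ A dU hA hAU). intro b.
      exists (Ci * RtoC (sqrt (8 * INR (3 * b + 2) ^ 3))); split.
      * apply Cmod_Ci_RtoC, sqrt_pos.
      * rewrite U_eq; apply U_moment_growth.
    + exact (order_two_thirds _ _ B dH hB hBH H_growth).
    + apply (order_two_thirds _ _ B (is_C_derivative_reflect _ _ dH) hB).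
      * intros z hz; unfold Hneg; rewrite <- (Cmod_opp z) in hz |- *; now apply hBH.
      * intro b; destruct (H_growth b) as [z [hz hb]].
        exists (- z); rewrite Cmod_opp; split; [exact hz|].
        unfold Hneg; now replace (- - z) with z by ring.
  - exact U_H.
Qed.
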